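(* Let $R$ be a skew-invertible Hecke symmetry of bi-rank $(m|0)$. The generating matrix $L(u)$ of the braided Yangian $\mathbf{Y}(R)$ satisfies the Cayley-Hamilton identity $$\sum_{p=0}^m(-q)^p\,L^{[m-p]}(q^{-2p}u)\,e_p(u)=0,$$ where by definition $L^{[0]}(u)=I$.
   Context: Conventions. $V$ is an $N$-dimensional vector space over $\mathbb{K}=\mathbb{R}$ or $\mathbb{C}$ with a fixed basis $\{x_i\}$. An operator $R$ on $V^{\otimes 2}$ has matrix given by $R(x_i\otimes x_j)=R_{ij}^{ks}x_k\otimes x_s$ (summation over repeated indices); matrix products are $(AB)_i^j=A_i^kB_k^j$. $R_k=R_{k\,k+1}$ is $R$ acting in tensor factors $k,k+1$; lower indices on operators indicate the tensor factors where they act; $L_1=L\otimes I$. Hecke symmetry: $R$ satisfies $R_{12}R_{23}R_{12}=R_{23}R_{12}R_{23}$ and $(qI-R)(q^{-1}I+R)=0$, with $q\in\mathbb{K}$ nonzero and generic ($q^n\neq 1$ for all nonzero integers $n$). Put $k_q=\frac{q^k-q^{-k}}{q-q^{-1}}$. Skew-invertible: there is $\Psi$ on $V^{\otimes 2}$ with $R_{ij}^{kl}\Psi_{lp}^{jq'}=\delta_i^{q'}\delta_p^k$. Put $C_i^j=\Psi_{ik}^{jk}$; $\mathrm{Tr}_R(X)=\mathrm{Tr}(XC)=C_i^jX_j^i$ for a matrix $X$ with entries in any algebra, and $\mathrm{Tr}_{R(a\dots b)}$ is the $R$-trace over tensor factors $a,\dots,b$. Skew-symmetrizers: $\mathcal{P}^{(1)}=I$,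 $\mathcal{P}^{(k+1)}_{1\dots k+1}=\frac{k_q}{(k+1)_q}\mathcal{P}^{(k)}_{1\dots k}\big(\frac{q^k}{k_q}I-R_k\big)\mathcal{P}^{(k)}_{1\dots k}$. $R$ has bi-rank $(m|0)$, $m\ge2$ (is even), if $\mathcal{P}^{(m)}\neq0$ and $\mathcal{P}^{(k)}=0$ for all $k>m$. Braided Yangian: let $R(u,v)=R-\frac{u(q-q^{-1})}{u-v}I$. $\mathbf{Y}(R)$ is the unital associative algebra generated by the entries $l_i^j[k]$ ($k\ge1$) of matrices $L[k]$, where $L(u)=\sum_{k\ge0}L[k]u^{-k}$, $L[0]=I$, subject to the relations obtained by expanding $R(u,v)L_1(u)RL_1(v)=L_1(v)RL_1(u)R(u,v)$. Notation: $L_{\overline1}(u)=L_1(u)$, $L_{\overline{k+1}}(u)=R_kL_{\overline k}(u)R_k^{-1}$. Elementary symmetric polynomials: $e_0(u)=1$, $e_k(u)=\mathrm{Tr}_{R(1\dots k)}\big(\mathcal{P}^{(k)}_{1\dots k}L_{\overline1}(u)L_{\overline2}(q^{-2}u)\cdots L_{\overline k}(q^{-2(k-1)}u)\big)$ for $k\ge1$. Matrix powers: $L^{[k]}(u)=\mathrm{Tr}_{R(2\dots k)}\big(L_{\overline1}(q^{-2(k-1)}u)L_{\overline2}(q^{-2(k-2)}u)\cdots L_{\overline k}(u)R_{k-1}\cdots R_2R_1\big)$, $k\ge1$; this equals $L(q^{-2(k-1)}u)L(q^{-2(k-2)}u)\cdots L(u)$. *)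

(* Defs.v *)
From HB Require Import structures.
From mathcomp Require Import all_boot all_order all_algebra.
From mathcomp Require Import boolp reals.
From mathcomp Require Import finmap complex.
From mathcomp.multinomials Require Import monalg.
Set Implicit Arguments. Unset Strict Implicit. Unset Printing Implicit Defensive.
Import GRing.Theory.
Local Open Scope ring_scope.

Definition real_or_complex (K : fieldType) : Prop :=
  exists R : realType, K = R :> fieldType \/ K = R[i] :> fieldType.

(* Formal series in u^-1: [f k] is the coefficient of u^-k. *)
Record fps (A : Type) := Fps { fpscoef :> nat -> A }.

Lemma fpsP (A : Type) (f g : fps A) : (forall k, f k = g k) <-> f = g.
Proof.
split=> [|-> //]; case: f g => [f] [g] /= h; congr Fps; exact/funext.
Qed.

HB.instance Definition _ (A : Type) := gen_eqMixin (fps A).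
HB.instance Definition _ (A : Type) := gen_choiceMixin (fps A).

Section FpsZmod.
Variable A : zmodType.
Implicit Types f g h : fps A.

Definition fps_zero : fps A := Fps (fun=> 0).
Definition fps_opp f : fps A := Fps (fun k => - f k).
Definition fps_add f g : fps A := Fps (fun k => f k + g k).

Fact fps_addA : associative fps_add.
Proof. by move=> f g h; apply/fpsP=> k /=; rewrite addrA. Qed.
Fact fps_addC : commutative fps_add.
Proof. by move=> f g; apply/fpsP=> k /=; rewrite addrC. Qed.
Fact fps_add0 : left_id fps_zero fps_add.
Proof. by move=> f; apply/fpsP=> k /=; rewrite add0r. Qed.
Fact fps_addN : left_inverse fps_zero fps_opp fps_add.
Proof. by move=> f; apply/fpsP=> k /=; rewrite addNr. Qed.

HB.instance Definition _ :=
  GRing.isZmodule.Build (fps A) fps_addA fps_addC fps_add0 fps_addN.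

End FpsZmod.

Section FpsRing.
Variable A : nzRingType.
Implicit Types f g h : fps A.

Definition fps_one : fps A := Fps (fun k => (k == 0%N)%:R).
Definition fps_mul f g : fps A :=
  Fps (fun k => \sum_(i < k.+1) f i * g (k - i)%N).

Let mul_rev f g n : fps_mul f g n = \sum_(i < n.+1) f (n - i)%N * g i.
Proof.
rewrite /= (reindex_inj rev_ord_inj) /=.
by apply: eq_bigr => i _; rewrite subSS subKn // -ltnS.
Qed.

Fact fps_mulA : associative fps_mul.
Proof.
move=> f g h; apply/fpsP=> n; rewrite [RHS]mul_rev.
pose t j k := f j * (g (n - j - k)%N * h k).
transitivity (\sum_(j < n.+1) \sum_(k < n.+1 | (k <= n - j)%N) t j k).
  rewrite [LHS]/=; apply: eq_bigr => j _.
  transitivity (f j * fps_mul g h (n - j)%N) => //; rewrite mul_rev mulr_sumr.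
  by rewrite (big_ord_narrow_leq (leq_subr _ _)).
rewrite (exchange_big_dep predT) //=; apply: eq_bigr => k _.
transitivity (\sum_(j < n.+1 | (j <= n - k)%N) t j k).
  apply: eq_bigl => j; rewrite -ltnS -(ltnS j) -!subSn ?leq_ord //.
  by rewrite -subn_gt0 -(subn_gt0 j) -!subnDA addnC.
rewrite (big_ord_narrow_leq (leq_subr _ _)) mulr_suml.
by apply: eq_bigr => j _; rewrite /t -!subnDA addnC mulrA.
Qed.

Fact fps_mul1r : left_id fps_one fps_mul.
Proof.
move=> f; apply/fpsP=> n /=; rewrite big_ord_recl /= mul1r subn0 big1 ?addr0 //.
by move=> i _; rewrite mul0r.
Qed.

Fact fps_mulr1 : right_id fps_one fps_mul.
Proof.
move=> f; apply/fpsP=> n /=.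
rewrite big_ord_recr /= subnn mulr1 big1 ?add0r //.
by move=> i _; rewrite subn_eq0 leqNgt ltn_ord mulr0.
Qed.

Fact fps_mulDl : left_distributive fps_mul +%R.
Proof.
move=> f g h; apply/fpsP=> n /=; rewrite -big_split.
by apply: eq_bigr => i _; rewrite mulrDl.
Qed.

Fact fps_mulDr : right_distributive fps_mul +%R.
Proof.
move=> f g h; apply/fpsP=> n /=; rewrite -big_split.
by apply: eq_bigr => i _; rewrite mulrDr.
Qed.

Fact fps_1neq0 : fps_one != 0.
Proof. by apply/eqP => /fpsP/(_ 0%N)/eqP; rewrite oner_eq0. Qed.

HB.instance Definition _ := GRing.Zmodule_isNzRing.Build (fps A)
  fps_mulA fps_mul1r fps_mulr1 fps_mulDl fps_mulDr fps_1neq0.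

End FpsRing.

Section FpsComRing.
Variable A : comNzRingType.

Fact fps_mulC : commutative (@GRing.mul (fps A)).
Proof.
move=> f g; apply/fpsP=> n /=; rewrite (reindex_inj rev_ord_inj) /=.
by apply: eq_bigr => i _; rewrite subSS subKn 1?mulrC // -ltnS.
Qed.

HB.instance Definition _ :=
  GRing.PzRing_hasCommutativeMul.Build (fps A) fps_mulC.

End FpsComRing.

Section FpsAlg.
Variables (K : pzRingType) (A : algType K).
Implicit Types (c : K) (f g : fps A).

Definition fps_scale c f : fps A := Fps (fun k => c *: f k).

Fact fps_scaleA c d f : fps_scale c (fps_scale d f) = fps_scale (c * d) f.
Proof. by apply/fpsP=> k /=; rewrite scalerA. Qed.
Fact fps_scale1 : left_id 1 fps_scale.
Proof. by move=> f; apply/fpsP=> k /=; rewrite scale1r. Qed.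
Fact fps_scaleDr : right_distributive fps_scale +%R.
Proof. by move=> c f g; apply/fpsP=> k /=; rewrite scalerDr. Qed.
Fact fps_scaleDl f : {morph fps_scale^~ f : c d / c + d}.
Proof. by move=> c d; apply/fpsP=> k /=; rewrite scalerDl. Qed.

HB.instance Definition _ := GRing.Zmodule_isLmodule.Build K (fps A)
  fps_scaleA fps_scale1 fps_scaleDr fps_scaleDl.

Fact fps_scaleAl c f g : c *: (f * g) = (c *: f) * g.
Proof.
apply/fpsP=> n /=; rewrite scaler_sumr.
by apply: eq_bigr => i _; rewrite scalerAl.
Qed.

HB.instance Definition _ := GRing.Lmodule_isLalgebra.Build K (fps A) fps_scaleAl.

Fact fps_scaleAr c f g : c *: (f * g) = f * (c *: g).
Proof.
apply/fpsP=> n /=; rewrite scaler_sumr.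
by apply: eq_bigr => i _; rewrite scalerAr.
Qed.

HB.instance Definition _ := GRing.Lalgebra_isAlgebra.Build K (fps A) fps_scaleAr.

End FpsAlg.

Definition fps_map (A B : Type) (phi : A -> B) (f : fps A) : fps B :=
  Fps (fun k => phi (f k)).

Definition fps_const (A : zmodType) (a : A) : fps A :=
  Fps (fun k => if k is 0%N then a else 0).

Definition fps_var (A : pzRingType) : fps A := Fps (fun k => (k == 1%N)%:R).

(* [fps_dil c f] is f(c u); since f is a series in u^-1, its k-th coefficient
   gets multiplied by c^-k. *)
Definition fps_dil (K : fieldType) (A : algType K) (c : K) (f : fps A) : fps A :=
  Fps (fun k => (c ^- k) *: f k).

Section FpsMap.
Variables (A B : nzRingType) (phi : {rmorphism A -> B}).

Fact fps_map_zmod : zmod_morphism (fps_map phi).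
Proof. by move=> f g; apply/fpsP=> k /=; rewrite rmorphB. Qed.
HB.instance Definition _ :=
  GRing.isZmodMorphism.Build (fps A) (fps B) (fps_map phi) fps_map_zmod.

Fact fps_map_monoid : monoid_morphism (fps_map phi).
Proof.
split=> [|f g]; apply/fpsP=> n /=; first by rewrite rmorph_nat.
by rewrite rmorph_sum; apply: eq_bigr => i _; rewrite rmorphM.
Qed.
HB.instance Definition _ :=
  GRing.isMonoidMorphism.Build (fps A) (fps B) (fps_map phi) fps_map_monoid.

End FpsMap.

Inductive ideal_gen (A : nzRingType) (S : A -> Prop) : A -> Prop :=
| ideal_gen0 : ideal_gen S 0
| ideal_genD x y : ideal_gen S x -> ideal_gen S y -> ideal_gen S (x + y)
| ideal_genM a x b : S x -> ideal_gen S (a * x * b).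

Record ideal2 (A : nzRingType) := Ideal2 {
  ideal2_mem :> A -> Prop;
  ideal2_0 : ideal2_mem 0;
  ideal2_B : forall x y, ideal2_mem x -> ideal2_mem y -> ideal2_mem (x - y);
  ideal2_Ml : forall a x, ideal2_mem x -> ideal2_mem (a * x);
  ideal2_Mr : forall a x, ideal2_mem x -> ideal2_mem (x * a);
  ideal2_1 : ~ ideal2_mem 1 }.

Section IdealGen.
Variables (A : nzRingType) (S : A -> Prop).

Fact ideal_gen_Ml a x : ideal_gen S x -> ideal_gen S (a * x).
Proof.
elim=> [|y z _ ihy _ ihz|b y c Sy]; first by rewrite mulr0; exact: ideal_gen0.
- by rewrite mulrDr; exact: ideal_genD.
- by rewrite !mulrA; exact: ideal_genM.
Qed.

Fact ideal_gen_Mr a x : ideal_gen S x -> ideal_gen S (x * a).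
Proof.
elim=> [|y z _ ihy _ ihz|b y c Sy]; first by rewrite mul0r; exact: ideal_gen0.
- by rewrite mulrDl; exact: ideal_genD.
- by rewrite -mulrA; exact: ideal_genM.
Qed.

Fact ideal_gen_B x y : ideal_gen S x -> ideal_gen S y -> ideal_gen S (x - y).
Proof.
by move=> Ix Iy; rewrite -mulN1r; apply: ideal_genD => //; exact: ideal_gen_Ml.
Qed.

Definition ideal2_gen (S1 : ~ ideal_gen S 1) : ideal2 A :=
  Ideal2 (ideal_gen0 S) ideal_gen_B ideal_gen_Ml ideal_gen_Mr S1.

End IdealGen.

Section QuotAlg.
Variables (K : pzRingType) (A : algType K) (I : ideal2 A).

Definition ideal_equiv : rel A := fun x y => `[< I (x - y) >].

Fact ideal_equivP : equiv_class_of ideal_equiv.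
Proof.
split=> [x|x y|y x z]; rewrite /ideal_equiv.
- by apply/asboolP; rewrite subrr; exact: ideal2_0.
- apply/asboolP/asboolP => h; rewrite -opprB -sub0r;
  by apply: ideal2_B h; exact: ideal2_0.
- move=> /asboolP h1 /asboolP h2; apply/asboolP.
  have -> : x - z = (x - y) - (0 - (y - z)) by rewrite sub0r opprK addrA addrNK.
  by apply: ideal2_B h1 _; apply: ideal2_B h2; exact: ideal2_0.
Qed.

Canonical ideal_equiv_equiv := EquivRelPack ideal_equivP.
Canonical ideal_equiv_encModRel := defaultEncModRel ideal_equiv.

Definition quotalg := {eq_quot ideal_equiv}%qT.
HB.instance Definition _ : EqQuotient A ideal_equiv quotalg :=
  EqQuotient.on quotalg.
HB.instance Definition _ := Choice.on quotalg.

Definition quot_pi (x : A) : quotalg := \pi_quotalg%qT x.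

Lemma quot_piP x y : I (x - y) <-> quot_pi x = quot_pi y.
Proof.
split=> [h|/eqP]; first by apply/eqP; rewrite /quot_pi piE; apply/asboolP.
by rewrite /quot_pi piE => /asboolP.
Qed.

Lemma quot_piK (x : quotalg) : quot_pi (repr x) = x.
Proof. exact: reprK. Qed.

Definition quot_opp (x : quotalg) := quot_pi (- repr x).
Definition quot_add (x y : quotalg) := quot_pi (repr x + repr y).
Definition quot_mul (x y : quotalg) := quot_pi (repr x * repr y).
Definition quot_scale (c : K) (x : quotalg) := quot_pi (c *: repr x).

Let I_repr x : I (repr (quot_pi x) - x).
Proof. by apply/quot_piP; rewrite quot_piK. Qed.

Let ID x y : I x -> I y -> I (x + y).
Proof.
move=> Ix Iy; rewrite -[y]opprK -sub0r addrC sub0r addrC.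
by apply: ideal2_B Ix _; rewrite -sub0r; apply: ideal2_B Iy; exact: ideal2_0.
Qed.

Lemma quot_piN x : quot_pi (- x) = quot_opp (quot_pi x).
Proof.
apply/quot_piP; rewrite opprK addrC; exact: I_repr.
Qed.

Lemma quot_piD x y : quot_pi (x + y) = quot_add (quot_pi x) (quot_pi y).
Proof.
by apply/esym/quot_piP; rewrite opprD addrACA; apply: ID; exact: I_repr.
Qed.

Lemma quot_piM x y : quot_pi (x * y) = quot_mul (quot_pi x) (quot_pi y).
Proof.
apply/esym/quot_piP; set x' := repr _; set y' := repr _.
have -> : x' * y' - x * y = (x' - x) * y' + x * (y' - y).
  by rewrite mulrBl mulrBr addrA addrNK.
by apply: ID; [apply: ideal2_Mr|apply: ideal2_Ml]; exact: I_repr.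
Qed.

Lemma quot_piZ c x : quot_pi (c *: x) = quot_scale c (quot_pi x).
Proof.
apply/esym/quot_piP; rewrite -scalerBr -[_ - x]mul1r scalerAl.
by apply: ideal2_Ml; exact: I_repr.
Qed.

Let piW (P : quotalg -> Prop) : (forall x, P (quot_pi x)) -> forall x, P x.
Proof. by move=> h x; rewrite -[x]quot_piK. Qed.

Fact quot_addA : associative quot_add.
Proof.
by elim/piW=> x; elim/piW=> y; elim/piW=> z; rewrite -!quot_piD addrA.
Qed.
Fact quot_addC : commutative quot_add.
Proof. by elim/piW=> x; elim/piW=> y; rewrite -!quot_piD addrC. Qed.
Fact quot_add0 : left_id (quot_pi 0) quot_add.
Proof. by elim/piW=> x; rewrite -quot_piD add0r. Qed.
Fact quot_addN : left_inverse (quot_pi 0) quot_opp quot_add.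
Proof. by elim/piW=> x; rewrite -quot_piN -quot_piD addNr. Qed.

HB.instance Definition _ :=
  GRing.isZmodule.Build quotalg quot_addA quot_addC quot_add0 quot_addN.

Fact quot_mulA : associative quot_mul.
Proof.
by elim/piW=> x; elim/piW=> y; elim/piW=> z; rewrite -!quot_piM mulrA.
Qed.
Fact quot_mul1r : left_id (quot_pi 1) quot_mul.
Proof. by elim/piW=> x; rewrite -quot_piM mul1r. Qed.
Fact quot_mulr1 : right_id (quot_pi 1) quot_mul.
Proof. by elim/piW=> x; rewrite -quot_piM mulr1. Qed.
Fact quot_mulDl : left_distributive quot_mul quot_add.
Proof.
elim/piW=> x; elim/piW=> y; elim/piW=> z.
by rewrite -!(quot_piM, quot_piD) mulrDl.
Qed.
Fact quot_mulDr : right_distributive quot_mul quot_add.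
Proof.
elim/piW=> x; elim/piW=> y; elim/piW=> z.
by rewrite -!(quot_piM, quot_piD) mulrDr.
Qed.
Fact quot_1neq0 : quot_pi 1 != 0.
Proof.
by apply/eqP => /(quot_piP 1 0); rewrite subr0; exact: ideal2_1.
Qed.

HB.instance Definition _ := GRing.Zmodule_isNzRing.Build quotalg
  quot_mulA quot_mul1r quot_mulr1 quot_mulDl quot_mulDr quot_1neq0.

Fact quot_scaleA c d x : quot_scale c (quot_scale d x) = quot_scale (c * d) x.
Proof. by elim/piW: x => x; rewrite -!quot_piZ scalerA. Qed.
Fact quot_scale1 : left_id 1 quot_scale.
Proof. by elim/piW=> x; rewrite -quot_piZ scale1r. Qed.
Fact quot_scaleDr : right_distributive quot_scale quot_add.
Proof.
move=> c; elim/piW=> x; elim/piW=> y.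
by rewrite -!(quot_piZ, quot_piD) scalerDr.
Qed.
Fact quot_scaleDl x : {morph quot_scale^~ x : c d / c + d >-> quot_add c d}.
Proof.
by elim/piW: x => x c d; rewrite -!(quot_piZ, quot_piD) scalerDl.
Qed.

HB.instance Definition _ := GRing.Zmodule_isLmodule.Build K quotalg
  quot_scaleA quot_scale1 quot_scaleDr quot_scaleDl.

Fact quot_scaleAl c (x y : quotalg) : c *: (x * y) = (c *: x) * y.
Proof.
elim/piW: x => x; elim/piW: y => y.
have sE a z : a *: quot_pi z = quot_pi (a *: z) by rewrite quot_piZ.
have mE a b : quot_pi a * quot_pi b = quot_pi (a * b) by rewrite quot_piM.
by rewrite !(sE, mE) scalerAl.
Qed.

HB.instance Definition _ :=
  GRing.Lmodule_isLalgebra.Build K quotalg quot_scaleAl.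

Fact quot_scaleAr c (x y : quotalg) : c *: (x * y) = x * (c *: y).
Proof.
elim/piW: x => x; elim/piW: y => y.
have sE a z : a *: quot_pi z = quot_pi (a *: z) by rewrite quot_piZ.
have mE a b : quot_pi a * quot_pi b = quot_pi (a * b) by rewrite quot_piM.
by rewrite !(sE, mE) scalerAr.
Qed.

HB.instance Definition _ :=
  GRing.Lalgebra_isAlgebra.Build K quotalg quot_scaleAr.

Fact quot_pi_zmod : zmod_morphism quot_pi.
Proof. by move=> x y; rewrite quot_piD quot_piN. Qed.
HB.instance Definition _ :=
  GRing.isZmodMorphism.Build A quotalg quot_pi quot_pi_zmod.
Fact quot_pi_monoid : monoid_morphism quot_pi.
Proof. by split=> // x y; rewrite quot_piM. Qed.
HB.instance Definition _ :=
  GRing.isMonoidMorphism.Build A quotalg quot_pi quot_pi_monoid.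
Fact quot_pi_scalable : scalable quot_pi.
Proof. by move=> c x; rewrite quot_piZ. Qed.
HB.instance Definition _ :=
  GRing.isScalable.Build K A quotalg *:%R quot_pi quot_pi_scalable.

End QuotAlg.

Definition free_alg (K : comNzRingType) (X : choiceType) := {malg K[{fmonom X}]}.

Section FreeAlg.
Variables (K : comNzRingType) (X : choiceType).

HB.instance Definition _ := GRing.Lalgebra.on (free_alg K X).

Fact free_alg_scaleAr c (x y : free_alg K X) : c *: (x * y) = x * (c *: y).
Proof.
apply/malgP=> k; rewrite mcoeffZ.
have sub : (msupp (c *: y) `<=` msupp (c *: y) `|` msupp y)%fset.
  exact: fsubsetUl.
rewrite (mcoeffMlw _ (fsubset_refl _) (fsubsetUr (msupp (c *: y)) (msupp y))).
rewrite (mcoeffMlw _ (fsubset_refl _) sub).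
rewrite mulr_sumr; apply: eq_bigr => i _; rewrite mulr_sumr.
by apply: eq_bigr => j _; rewrite mcoeffZ mulrnAr mulrCA.
Qed.

HB.instance Definition _ :=
  GRing.Lalgebra_isAlgebra.Build K (free_alg K X) free_alg_scaleAr.

Definition free_gen (x : X) : free_alg K X := << fmu x >>.

End FreeAlg.

(* A basis of the n-th tensor power (n >= 1) is indexed by the maps from
   factors to 'I_N; the index type 'I_n.-1.+1 is 'I_n for n >= 1. *)
Notation midx N n := {ffun 'I_n.-1.+1 -> 'I_N}.

(* Factors are numbered from 1. *)
Definition tfactor (n k : nat) : 'I_n.-1.+1 := inord k.-1.

(* In all matrices the row index is the lower one and the column index is the
   upper one, so that [*m] is (AB)_i^j = A_i^k B_k^j. *)
Definition tentry (A : Type) (N n : nat) (X : 'M[A]_#|midx N n|)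
    (a b : midx N n) : A := X (enum_rank a) (enum_rank b).

Definition tmatrix (A : Type) (N n : nat) (f : midx N n -> midx N n -> A) :
    'M[A]_#|midx N n| := \matrix_(i, j) f (enum_val i) (enum_val j).

Definition pair_idx (N : nat) (i j : 'I_N) : midx N 2 :=
  [ffun t => if t == ord0 then i else j].

(* [entry2 R i j k s] is R_(ij)^(ks). *)
Definition entry2 (A : Type) (N : nat) (X : 'M[A]_#|midx N 2|)
    (i j k s : 'I_N) : A := tentry X (pair_idx i j) (pair_idx k s).

(* [X] acting in factors k, k+1 *)
Definition at_factors (A : pzSemiRingType) (N n k : nat) (X : 'M[A]_#|midx N 2|) :
    'M[A]_#|midx N n| :=
  let s := tfactor n k in let s' := tfactor n k.+1 in
  tmatrix (fun a b => entry2 X (a s) (a s') (b s) (b s') *+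
    [forall t, (t != s) ==> (t != s') ==> (a t == b t)]).

(* [X] acting in factor 1 *)
Definition at_first (A : pzSemiRingType) (N n : nat) (X : 'M[A]_N) :
    'M[A]_#|midx N n| :=
  let s := tfactor n 1 in
  tmatrix (fun a b => X (a s) (b s) *+ [forall t, (t != s) ==> (a t == b t)]).

Section HeckeSymmetry.
Variables (K : fieldType) (N : nat) (R : 'M[K]_#|midx N 2|) (q : K).

Definition qint (k : nat) : K := (q ^+ k - q ^- k) / (q - q^-1).

Definition hecke_symmetry : Prop :=
  (let R12 := at_factors 3 1 R in let R23 := at_factors 3 2 R in
   R12 *m R23 *m R12 = R23 *m R12 *m R23) /\
  (q%:M - R) *m (q^-1%:M + R) = 0.

Definition skew_inverse (Psi : 'M[K]_#|midx N 2|) : Prop :=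
  forall i k p r : 'I_N,
    \sum_j \sum_l entry2 R i j k l * entry2 Psi l p j r
    = (i == r)%:R * (p == k)%:R.

(* P^(k) in the first k of n factors; the value at k = 0 is not used. *)
Fixpoint skew_symmetrizer (n k : nat) : 'M[K]_#|midx N n| :=
  if k isn't j.+1 then 1%:M else
  if j is 0%N then 1%:M else
  (qint j / qint j.+1) *:
    (skew_symmetrizer n j *m ((q ^+ j / qint j)%:M - at_factors n j R)
     *m skew_symmetrizer n j).

Definition birank0 (m : nat) : Prop :=
  skew_symmetrizer m m <> 0 /\
  forall k, (m < k)%N -> skew_symmetrizer k k = 0.

End HeckeSymmetry.

Definition C_matrix (K : fieldType) (N : nat) (Psi : 'M[K]_#|midx N 2|) : 'M[K]_N :=
  \matrix_(i, j) \sum_k entry2 Psi i k j k.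

Section RTrace.
Variables (K : fieldType) (N : nat) (C : 'M[K]_N) (A : algType K) (n : nat).

(* Tr_(R(1...n)) *)
Definition rtrace (X : 'M[A]_#|midx N n|) : A :=
  \sum_(a : midx N n) \sum_(b : midx N n)
    (\prod_t C (a t) (b t)) *: tentry X b a.

(* Tr_(R(2...n)), a matrix acting in factor 1 *)
Definition rtrace_tail (X : 'M[A]_#|midx N n|) : 'M[A]_N :=
  let s := tfactor n 1 in
  \matrix_(i, j) \sum_(a : midx N n | a s == j) \sum_(b : midx N n | b s == i)
    (\prod_(t | t != s) C (a t) (b t)) *: tentry X b a.

End RTrace.

Section GeneratingMatrix.
Variables (K : fieldType) (N : nat) (R : 'M[K]_#|midx N 2|) (q : K).
Variables (C : 'M[K]_N) (A : algType K) (L : 'M[fps A]_N).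

Local Notation lift := (map_mx (in_alg (fps A))).

(* L(c u) *)
Definition Ldil (c : K) : 'M[fps A]_N := map_mx (fps_dil c) L.

(* L_(bar k)(c u) in n factors, for k >= 1; the value at k = 0 is not used. *)
Fixpoint Lbar (n k : nat) (c : K) : 'M[fps A]_#|midx N n| :=
  if k isn't j.+1 then 1%:M else
  if j is 0%N then at_first n (Ldil c) else
  lift (at_factors n j R) *m Lbar n j c *m lift (invmx (at_factors n j R)).

(* e_k(u) *)
Definition elem_sym (k : nat) : fps A :=
  if k is 0%N then 1 else
  rtrace C (lift (skew_symmetrizer R q k k) *m
    \big[mulmx/1%:M]_(1 <= j < k.+1) Lbar k j (q ^- (2 * j.-1))).

(* L^[k](u) *)
Definition Lpow (k : nat) : 'M[fps A]_N :=
  if k is 0%N then 1%:M else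
  rtrace_tail C
    ((\big[mulmx/1%:M]_(1 <= j < k.+1) Lbar k j (q ^- (2 * (k - j)))) *m
     lift (\big[mulmx/1%:M]_(1 <= j < k) at_factors k (k - j) R)).

End GeneratingMatrix.

Section YangianRelations.
Variables (K : fieldType) (N : nat) (R : 'M[K]_#|midx N 2|) (q : K).

(* The difference of both sides of R(u,v) L_1(u) R L_1(v) = L_1(v) R L_1(u) R(u,v),
   with the denominator u - v of R(u,v) cleared: both sides are multiplied by
   the central element u^-1 v^-1 (u - v) = v^-1 - u^-1, which turns R(u,v) into
   [D] = (v^-1 - u^-1) R - v^-1 (q - q^-1) I.  Double series are series in u^-1
   whose coefficients are series in v^-1. *)
Definition yangian_rel (A : algType K) (L : 'M[fps A]_N) :
    'M[fps (fps A)]_#|midx N 2| :=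
  let uV : fps (fps A) := fps_var (fps A) in
  let vV : fps (fps A) := fps_const (fps_var A) in
  let Lu := at_first 2 (map_mx (fps_map (@fps_const A)) L) in
  let Lv := at_first 2 (map_mx (@fps_const (fps A)) L) in
  let R' := map_mx (in_alg (fps (fps A))) R in
  let D := (vV - uV) *: R' - ((q - q^-1) *: vV)%:M in
  D *m Lu *m R' *m Lv - Lv *m R' *m Lu *m D.

(* The generator (k, i, j) stands for l_i^j[k+1]. *)
Let F := free_alg K (nat * 'I_N * 'I_N)%type.

Definition free_L : 'M[fps F]_N :=
  \matrix_(i, j) Fps (fun k =>
    if k is p.+1 then free_gen K (p, i, j) else (i == j)%:R).

Definition yangian_relator (x : F) : Prop :=
  exists i j a b, x = yangian_rel free_L i j a b.

End YangianRelations.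

Section YangianProper.
Variables (K : fieldType) (N : nat) (R : 'M[K]_#|midx N 2|) (q : K).

Let map_at_first (A B : nzRingType) (phi : {rmorphism A -> B}) (X : 'M[A]_N) :
  map_mx phi X = 1%:M -> map_mx phi (at_first 2 X) = 1%:M.
Proof.
move=> /matrixP X1; apply/matrixP => i j; rewrite !mxE rmorphMn.
have := X1 (enum_val i (tfactor 2 1)) (enum_val j (tfactor 2 1)).
rewrite !mxE => ->; rewrite -mulrnA mulnb; congr (_ *+ _).
congr nat_of_bool; apply/andP/eqP => [[/eqP e /forallP h]|->]; last first.
  by split=> //; apply/forallP=> t; apply/implyP.
apply: enum_val_inj; apply/ffunP => t; have [-> //|ne] := eqVneq t (tfactor 2 1).
exact/eqP/(implyP (h t)).
Qed.

Let map_comm (A : nzRingType) (B : comNzRingType) (phi : {rmorphism A -> B})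
    (n : nat) (d e : A) (M X Y : 'M[A]_n) :
  map_mx phi X = 1%:M -> map_mx phi Y = 1%:M ->
  map_mx phi ((d *: M - e%:M) *m X *m M *m Y - Y *m M *m X *m (d *: M - e%:M)) = 0.
Proof.
move=> X1 Y1.
rewrite map_mxB !map_mxM X1 Y1 !mulmx1 mul1mx map_mxB map_mxZ map_scalar_mx.
by rewrite mulmxBl mulmxBr -scalemxAl -scalemxAr scalar_mxC subrr.
Qed.

Let map_rel (A : algType K) (B : comNzRingType)
    (phi : {rmorphism fps (fps A) -> B}) (L : 'M[fps A]_N) :
  map_mx phi (map_mx (fps_map (@fps_const A)) L) = 1%:M ->
  map_mx phi (map_mx (@fps_const (fps A)) L) = 1%:M ->
  map_mx phi (yangian_rel R q L) = 0.
Proof.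
move=> /map_at_first Lu1 /map_at_first Lv1.
exact: map_comm.
Qed.

Local Notation X := (nat * 'I_N * 'I_N)%type.
Local Notation F := (free_alg K X).

Let aug : F -> K := mcoeff (@mone {fmonom _}).
Let aug_zmod : zmod_morphism aug.
Proof. by move=> x y; rewrite /aug mcoeffB. Qed.
Let aug_monoid : monoid_morphism aug.
Proof.
by have [augM aug1] := @mcoeff1g_is_multiplicative {fmonom X} K; split.
Qed.
HB.instance Definition _ := GRing.isZmodMorphism.Build F K aug aug_zmod.
HB.instance Definition _ := GRing.isMonoidMorphism.Build F K aug aug_monoid.

Let aug_gen x : aug (free_gen K x) = 0.
Proof. by rewrite /aug /free_gen /= mcoeffU1 fm1_eq1. Qed.

Let aug_L i j k : aug (free_L K N i j k) = ((i == j) && (k == 0%N))%:R.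
Proof.
by rewrite mxE; case: k => [|k] /=; rewrite ?andbT ?andbF ?rmorph_nat ?aug_gen.
Qed.

Fact yangian_proper : ~ ideal_gen (yangian_relator R q) 1.
Proof.
have aug0 x : yangian_relator R q x -> aug x = 0.
  move=> [i [j [a [b ->]]]].
  have /matrixP/(_ i j) : map_mx (fps_map (fps_map aug))
      (yangian_rel R q (free_L K N)) = 0.
    apply: map_rel; apply/matrixP => k l; rewrite mxE [map_mx _ _ k l]mxE [RHS]mxE;
    apply/fpsP => c; apply/fpsP => d /=.
    - case: d => [|d]; rewrite ?[aug _]aug_L ?rmorph0.
        by case: c => [|c]; case: (k == l).
      by case: c => [|c]; case: (k == l).
    - case: c => [|c] /=; rewrite ?[aug _]aug_L ?rmorph0.
        by case: d => [|d]; case: (k == l).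
      by case: d => [|d]; case: (k == l).
  by rewrite [LHS]mxE [RHS]mxE => /fpsP/(_ a)/fpsP/(_ b).
suff h x : ideal_gen (yangian_relator R q) x -> aug x = 0.
  by move=> /h /eqP; rewrite rmorph1 oner_eq0.
elim=> [|y z _ hy _ hz|y z t /aug0 h]; first exact: rmorph0.
- by rewrite rmorphD [X in X + _]hy [X in _ + X]hz addr0.
- by rewrite !rmorphM [X in _ * X * _]h mulr0 mul0r.
Qed.

End YangianProper.

Definition yangian (K : fieldType) (N : nat) (R : 'M[K]_#|midx N 2|) (q : K) :=
  quotalg (ideal2_gen (@yangian_proper K N R q)).

HB.instance Definition _ (K : fieldType) (N : nat) (R : 'M[K]_#|midx N 2|) (q : K) :=
  GRing.Algebra.on (yangian R q).

(* L(u) = sum_k L[k] u^-k with L[0] = I *)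
Definition yangian_L (K : fieldType) (N : nat) (R : 'M[K]_#|midx N 2|) (q : K) :
    'M[fps (yangian R q)]_N :=
  map_mx (fps_map (@quot_pi _ _ _)) (free_L K N).

(* Main.v *)
(* Let P_k be the k-th skew-symmetrizer, L_k the copy L_(bar k), and
     W_k(u) = Tr_(R(2...k)) (L_1(q^(-2(k-1)) u) ... L_k(u) P_k).
   Fusion, i.e. P_(k+1) = c P_k A_k(k) ... A_1(1) with A_i(n) = q^n/n_q - R_i, which is
   R(u, q^(-2n) u) up to a scalar, reverses the order of the spectral parameters, so
   e_k(u) is the full R-trace of the same expression. The mirrored recursion
     (k+1)_q P_(k+1) = P' (q^k - k_q R_1) P',   P' = P_k in the factors 2, ..., k+1,
   and the properties of the R-trace give the Newton recursion
     (k+1)_q W_(k+1)(u) = L(q^(-2k) u) (q^k e_k(u) - k_q W_k(u)).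
   As L^[k+1](u) = L(q^(-2k) u) L^[k](u), the left-hand side S_k of the Cayley-Hamilton
   identity for k instead of m satisfies S_k = (-1)^k (q^k e_k(u) - k_q W_k(u)). Hence
   L(q^(-2m) u) S_m = +-(m+1)_q W_(m+1)(u) = 0 because P_(m+1) = 0, and S_m = 0 because
   L(u) = 1 + O(u^-1) is invertible. *)

(* The entries of L do not commute, so a trace of a product of copies of L is not cyclic. What can
   be carried round the trace is what the R_j with j >= 2 generate, because factor 1 stays untraced.
   This is why the recursion for P_(k+1) has to be mirrored: its outer factors P' then live in the
   traced factors 2, ..., k+1 and can be absorbed. Let F be the operator under the trace in W_k,
   moved to these factors by conjugation with R_1 ... R_k. The remaining middle factor q^k - k_q R_1
   needs two evaluations over the factors 2, ..., k+1: F gives e_k(u) I, by Tr_(R(2)) R_12 X_1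
   R_12^(-1) = Tr_R(X) I, and F R_1 gives W_k(u), by Tr_(R(2)) R_12 = I. Only the parameters q^(-2a)
   u occur. The Newton recursion is therefore proved for an abstract sequence of matrices with one
   exchange relation in two factors, which comes from the two-variable relation by the substitution
   u^-1 := c u^-1, v^-1 := d u^-1. *)
Require Import Defs.
From HB Require Import structures.
From mathcomp Require Import all_boot all_order all_algebra.
From mathcomp Require Import reals complex zify ring.
Set Implicit Arguments. Unset Strict Implicit. Unset Printing Implicit Defensive.
Import GRing.Theory.
Local Open Scope ring_scope.

(** * q-integers *)

Section QInt.
Variables (K : fieldType) (q : K).
Hypotheses (hq0 : q != 0) (hq : forall n : int, n != 0 -> q ^ n != 1).

Lemma qdiff_neq0 n : (0 < n)%N -> q ^+ n - q ^- n != 0.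
Proof.
move=> n0; rewrite subr_eq0; apply/eqP => e.
have /hq/eqP : Posz (n + n)%N != 0 by case: n n0 {e}.
by apply; rewrite -exprnP exprD {1}e mulVf // expf_neq0.
Qed.

Lemma qint_neq0 n : (0 < n)%N -> qint q n != 0.
Proof.
move=> n0; rewrite /qint mulf_neq0 ?qdiff_neq0 // invr_eq0.
by have := qdiff_neq0 (ltn0Sn 0); rewrite !expr1.
Qed.

Lemma qint1 : qint q 1 = 1.
Proof.
by rewrite /qint !expr1 divff //; have := qdiff_neq0 (ltn0Sn 0); rewrite expr1.
Qed.

(* The weights [q^n / n_q] of the baxterized elements satisfy the functional
   equation behind the Yang-Baxter equation. *)
Definition bweight (n : nat) : K := q ^+ n / qint q n.

(** Since [bweight n] is (q - q^-1)/(1 - q^(-2n)), with x = q^(-2a) and y = q^(-2b) this is the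
    identity 1/((1-x)(1-y)) = (1/(1-xy)) (1/(1-x) + 1/(1-y) - 1). *)
Lemma bweightD a b : (0 < a)%N -> (0 < b)%N ->
  bweight a * bweight b
  = bweight (a + b) * (bweight a + bweight b - (q - q^-1)).
Proof.
move=> a0 b0; have ab0 : (0 < a + b)%N by rewrite addn_gt0 a0.
rewrite /bweight /qint.
have := qdiff_neq0 (ltn0Sn 0); rewrite !expr1 => d1.
have da := qdiff_neq0 a0; have db := qdiff_neq0 b0; have := qdiff_neq0 ab0.
rewrite !exprD; move: da db; set x := q ^+ a; set y := q ^+ b => da db dab.
have x0 : x != 0 by rewrite expf_neq0.
have y0 : y != 0 by rewrite expf_neq0.
(* [field] asks for z^2 - 1 to be nonzero, while genericity speaks of z - z^-1. *)
have cl (z : K) : z != 0 -> z - z^-1 != 0 -> z ^+ 2 - 1 != 0.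
  by move=> z0 dz; rewrite -(divff z0) expr2 -mulrBr mulf_neq0.
have h1 := cl _ hq0 d1; have h2 := cl _ x0 da; have h3 := cl _ y0 db.
have xy0 : x * y != 0 by rewrite mulf_neq0.
have h4 := cl _ xy0 dab.
field.
by rewrite -!expr2 hq0 x0 y0 h1 h2 h3 h4.
Qed.

(** The value of a baxterized factor where its generator acts by -q^-1. Its inverse is the
    normalising constant in the recursion for the skew-symmetrizers. *)
Lemma bweight_add_inv n : (0 < n)%N -> bweight n + q^-1 = qint q n.+1 / qint q n.
Proof.
move=> n0; apply: (canRL (mulfK (qint_neq0 n0))).
rewrite mulrDl /bweight mulfVK ?qint_neq0 // /qint.
have := qdiff_neq0 (ltn0Sn 0); rewrite !expr1 => d1.
have x0 : q ^+ n != 0 by rewrite expf_neq0.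
rewrite !exprS; field.
rewrite hq0 x0 /= -expr2 andbT; apply: contra d1.
by rewrite !subr_eq0 expr2 => /eqP e; rewrite -[q in q == _](mulfK hq0) e mul1r.
Qed.

Lemma bweight1 : bweight 1 = q.
Proof. by rewrite /bweight qint1 divr1. Qed.

End QInt.

(** * Skew-symmetrizers in a Hecke algebra *)

Lemma prod_nat_comm (M : pzRingType) (F : nat -> M) x m n :
  (forall j, (m <= j < n)%N -> x * F j = F j * x) ->
  x * \prod_(m <= j < n) F j = \prod_(m <= j < n) F j * x.
Proof.
by move=> h; rewrite big_nat; apply: commr_prod => j; exact: h.
Qed.

Section SkewSymmetrizer.
Variables (K : fieldType) (q : K).
Hypotheses (hq0 : q != 0) (hq : forall n : int, n != 0 -> q ^ n != 1).
Variables (M : pzRingType) (s : {rmorphism K -> M}).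
Hypothesis sC : forall c x, s c * x = x * s c.

(* [s] embeds the scalars as central elements: square matrices of size 0 or over a
   noncommutative ring do not form a K-algebra in the sense of MathComp. *)
Definition hecke_rel (n : nat) (r : nat -> M) : Prop :=
  [/\ forall i, (0 < i)%N -> (i.+1 < n)%N ->
        r i * r i.+1 * r i = r i.+1 * r i * r i.+1,
      forall i j, (0 < i)%N -> (i.+1 < j)%N -> (j < n)%N -> r i * r j = r j * r i
    & forall i, (0 < i)%N -> (i < n)%N -> (s q - r i) * (s q^-1 + r i) = 0].

(** The generators are a parameter, so that the same recursion also gives the skew-symmetrizers of
    the shifted and of the reversed generators. *)
Fixpoint asym (r : nat -> M) (k : nat) : M :=
  if k isn't j.+1 then 1 else
  if j is 0%N then 1 else
  s (qint q j / qint q j.+1) *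
    (asym r j * (s (bweight q j) - r j) * asym r j).

Definition baxter (r : nat -> M) i n : M := s (bweight q n) - r i.

Arguments asym : simpl never.

Lemma asymS r k : (0 < k)%N ->
  asym r k.+1 = s (qint q k / qint q k.+1) *
    (asym r k * baxter r k k * asym r k).
Proof. by case: k. Qed.

Let mA (x y z : M) : x * (y * z) = x * y * z.
Proof. exact: mulrA. Qed.

Lemma mulsA c x y : x * (s c * y) = s c * (x * y).
Proof. by rewrite !mulrA sC. Qed.

Lemma quad_sqr x : (s q - x) * (s q^-1 + x) = 0 -> x * x = 1 + s (q - q^-1) * x.
Proof.
rewrite mulrDr !mulrBl -rmorphM mulfV // rmorph1 -(sC _ x) rmorphB mulrBl => e.
apply/esym/eqP; rewrite -subr_eq0; apply/eqP; rewrite -[RHS]e.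
by rewrite !addrA; congr (_ - _); rewrite addrAC.
Qed.

(** The baxterized factor of weight [bweight 1 = q] is q - x, and the Hecke relation makes it an
    eigenvector of x. Skewness of [asym] is reduced to this factor. *)
Lemma quad_baxter1 x : (s q - x) * (s q^-1 + x) = 0 ->
  (x * (s q - x) = s (- q^-1) * (s q - x)) /\
  ((s q - x) * x = s (- q^-1) * (s q - x)).
Proof.
move=> e; have e2 : (s q - x) * x = s (- q^-1) * (s q - x).
  move/eqP: e; rewrite mulrDr addrC addr_eq0 => /eqP ->.
  by rewrite rmorphN mulNr sC.
split=> //; rewrite -[RHS]e2 mulrBl mulrBr; congr (_ - _); exact/esym/sC.
Qed.

(** Up to the cubic term, the right-hand side is invariant under exchanging r with t and x with z;
    the braid relation takes care of the cubic term. The Yang-Baxter equation follows by expanding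
    both of its sides in this way. *)
Lemma yb_expand r t (x y z : K) :
  r * r = 1 + s (q - q^-1) * r -> x * z = y * (x + z - (q - q^-1)) ->
  (s x - r) * (s y - t) * (s z - r)
  = (s (x * y * z) + s y - s (x * z) * (r + t))
    + (s x * t * r + s z * r * t) - r * t * r.
Proof.
move=> rr exz; rewrite !mulrBl !mulrBr !mulrBl.
rewrite -[in r * s y](sC y r) -![_ * s z]sC !mulrA -!rmorphM.
rewrite -(mulrA (s y)) rr mulrDr mulr1 (mulrA (s y)) -(rmorphM s y).
rewrite (_ : z * x * y = x * y * z); last by ring.
rewrite [(z * x)%R]mulrC [(z * y)%R]mulrC (mulrDr (s (x * z)) r t).
(* The quadratic relation contributes y (q - q^-1) r, and the weight equation then makes the
   coefficient of r equal to that of t. *)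
have -> : s (x * z) * r = s (x * y) * r + s (y * z) * r - s (y * (q - q^-1)) * r.
  rewrite -mulrDl -mulrBl -rmorphD -rmorphB exz; congr (s _ * _); ring.
move: (s (x * y * z)) (s y) (s x * t * r) (s z * r * t) (r * t * r) (s (x * z) * t).
move: (s (x * y) * r) (s (y * z) * r) (s (y * (q - q^-1)) * r).
move=> a b c d e f g h i.
rewrite !(opprB, opprD) !addrA.
by rewrite [LHS](ACl (1*5*6*4*9*2*3*8*7)).
Qed.

Lemma yang_baxter r t a b :
  r * t * r = t * r * t -> (s q - r) * (s q^-1 + r) = 0 ->
  (s q - t) * (s q^-1 + t) = 0 -> (0 < a)%N -> (0 < b)%N ->
  (s (bweight q a) - r) * (s (bweight q (a + b)) - t) * (s (bweight q b) - r)
  = (s (bweight q b) - t) * (s (bweight q (a + b)) - r) * (s (bweight q a) - t).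
Proof.
move=> brt /quad_sqr rr /quad_sqr tt a0 b0.
have e1 := bweightD hq0 hq a0 b0.
have e2 := bweightD hq0 hq b0 a0; rewrite (addnC b) in e2.
rewrite (yb_expand _ rr e1) (yb_expand _ tt e2).
move: (bweight q a) (bweight q (a + b)) (bweight q b) => x y z. 
have e : z * y * x = x * y * z by ring.
rewrite e.
rewrite brt (addrC t r) (mulrC z x) (addrC (s z * r * t)).
done.
Qed.

Section Relations.
Variables (n : nat) (r : nat -> M).
Hypothesis hr : hecke_rel n r.

Let braid i : (0 < i)%N -> (i.+1 < n)%N -> r i * r i.+1 * r i = r i.+1 * r i * r i.+1.
Proof. by case: hr => h _ _; exact: h. Qed.
Let quad i : (0 < i)%N -> (i < n)%N -> (s q - r i) * (s q^-1 + r i) = 0.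
Proof. by case: hr => _ _ h; exact: h. Qed.
Let far i j : (0 < i)%N -> (i.+1 < j)%N -> (j < n)%N -> r i * r j = r j * r i.
Proof. by case: hr => _ h _; exact: h. Qed.

Lemma eq_asym r' k : (forall i, (0 < i)%N -> (i < k)%N -> r i = r' i) ->
  asym r k = asym r' k.
Proof.
elim: k => [|[|k] ih] h //; rewrite (asymS r) // (asymS r') // ih => [|i i0 ik].
  by rewrite /baxter h.
by apply: h => //; exact: ltnW.
Qed.

Lemma asym_comm k x :
  (forall i, (0 < i)%N -> (i < k)%N -> r i * x = x * r i) ->
  asym r k * x = x * asym r k.
Proof.
move=> h; apply: commr_sym; elim: k => [|[|k] ih] in h *; try exact: commr1.
have cs c : GRing.comm x (s c) by exact/esym/sC.
have {}ih : GRing.comm x (asym r k.+1).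
  by apply: ih => i i0 ik; apply: h => //; exact: ltnW.
rewrite asymS //; apply: commrM => //; do 2![apply: commrM => //].
by apply: commrB => //; exact/esym/h.
Qed.

Definition skewl k x := forall i, (0 < i)%N -> (i < k)%N -> r i * x = s (- q^-1) * x.
Definition skewr k x := forall i, (0 < i)%N -> (i < k)%N -> x * r i = s (- q^-1) * x.

Lemma baxter_skewl k x i m : skewl k x -> (0 < i)%N -> (i < k)%N -> (0 < m)%N ->
  baxter r i m * x = s (qint q m.+1 / qint q m) * x.
Proof.
by move=> h i0 ik m0; rewrite mulrBl h // -mulrBl -rmorphB opprK bweight_add_inv.
Qed.

Lemma baxter_skewr k x i m : skewr k x -> (0 < i)%N -> (i < k)%N -> (0 < m)%N ->
  x * baxter r i m = s (qint q m.+1 / qint q m) * x.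
Proof.
by move=> h i0 ik m0; rewrite mulrBr h // -sC -mulrBl -rmorphB opprK bweight_add_inv.
Qed.

Lemma qint_ratio k : (0 < k)%N ->
  s (qint q k / qint q k.+1) * s (qint q k.+1 / qint q k) = 1.
Proof.
move=> k0; rewrite -rmorphM mulrA mulfVK ?qint_neq0 // divff ?qint_neq0 //.
exact: rmorph1.
Qed.

(** On a skew element the middle factor of each stage acts by (k+1)_q/k_q, which the prefactor
    k_q/(k+1)_q cancels. *)
Lemma asym_absorbl k x : skewl k x -> asym r k * x = x.
Proof.
elim: k => [|[|k] ih] h; rewrite ?mul1r //.
have {}ih : asym r k.+1 * x = x.
  by apply: ih => i i0 ik; apply: h => //; exact: ltnW.
by rewrite asymS // -!mA ih (baxter_skewl h) //
  (mulsA _ (asym r k.+1)) ih mA qint_ratio ?mul1r.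
Qed.

Lemma asym_absorbr k x : skewr k x -> x * asym r k = x.
Proof.
elim: k => [|[|k] ih] h; rewrite ?mulr1 //.
have {}ih : x * asym r k.+1 = x.
  by apply: ih => i i0 ik; apply: h => //; exact: ltnW.
rewrite asymS // mulsA (mA x) (mA x) ih (baxter_skewr h) //.
by rewrite -mA ih mA qint_ratio ?mul1r.
Qed.

Lemma baxter_comm i m x : r i * x = x * r i -> baxter r i m * x = x * baxter r i m.
Proof. by move=> e; rewrite mulrBl mulrBr e sC. Qed.

(** The letters [a] and [t] stand for the baxterized factors of two neighbouring generators, the
    suffix for the weight. One P releases a factor [a1] that it absorbs, the other is opened to Q ak
    Q; as Q commutes with [tm] and [t1], the Yang-Baxter equation applies in the middle and brings
    [t1] to the outside. *)
Lemma fusion_step (P Q a1 ak am t1 tk tm : M) (c d : K) :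
  Q * tm = tm * Q -> Q * t1 = t1 * Q -> Q * P = P -> P * Q = P ->
  P = s d * (a1 * P) -> P = s d * (P * a1) -> P = s c * (Q * ak * Q) ->
  ak * tm * a1 = t1 * am * tk -> a1 * tm * ak = tk * am * t1 ->
  P * tm * P = t1 * (s c * s d * (Q * am * tk * P)) /\
  P * tm * P = s c * s d * (P * tk * am * Q) * t1.
Proof.
move=> Qm Q1 QP PQ Pl Pr eP yb1 yb2; split.
  rewrite {1}eP -!mA !(mulsA _ t1); congr (s _ * _).
  rewrite (mA Q tm) Qm -mA QP {1}Pl !mulsA; congr (s _ * _).
  rewrite (mA t1) -Q1 -!mA; congr (Q * _).
  by rewrite !mA yb1.
rewrite {2}eP mulsA -!mA; congr (s _ * _).
rewrite (mA tm) -Qm -!mA (mA P) PQ {1}Pr -!mA; congr (s _ * _).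
congr (P * _); rewrite (mA a1) (mA (a1 * _)) yb2 -!mA.
by rewrite Q1.
Qed.

(* The middle factor of [asym r k.+3] is pushed by the Yang-Baxter equation past
   a factor [baxter r k.+1 1] that [asym r k.+2] absorbs. *)
Lemma asym_step k : (k.+2 < n)%N ->
  skewl k.+2 (asym r k.+2) -> skewr k.+2 (asym r k.+2) ->
  exists x y, asym r k.+3 = baxter r k.+2 1 * x /\ asym r k.+3 = y * baxter r k.+2 1.
Proof.
move=> kn hl hr'.
have Qc m : asym r k.+1 * baxter r k.+2 m = baxter r k.+2 m * asym r k.+1.
  by apply: asym_comm => i i0 ik; apply/esym/baxter_comm/esym/far.
have QP : asym r k.+1 * asym r k.+2 = asym r k.+2.
  by apply: asym_absorbl => i i0 ik; apply: hl => //; exact: ltnW.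
have PQ : asym r k.+2 * asym r k.+1 = asym r k.+2.
  by apply: asym_absorbr => i i0 ik; apply: hr' => //; exact: ltnW.
have u := qint_ratio (ltn0Sn 0).
have Pl : asym r k.+2 = s (qint q 1 / qint q 2) * (baxter r k.+1 1 * asym r k.+2).
  by rewrite (baxter_skewl hl) // mA u mul1r.
have Pr : asym r k.+2 = s (qint q 1 / qint q 2) * (asym r k.+2 * baxter r k.+1 1).
  by rewrite (baxter_skewr hr') // mA u mul1r.
have br : r k.+1 * r k.+2 * r k.+1 = r k.+2 * r k.+1 * r k.+2 by exact: braid.
have [q1 q2] := (quad (ltn0Sn k) (ltnW kn), quad (ltn0Sn k.+1) kn).
have yb1 := yang_baxter br q1 q2 (ltn0Sn k) (ltn0Sn 0).
have yb2 := yang_baxter br q1 q2 (ltn0Sn 0) (ltn0Sn k).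
rewrite addn1 in yb1; rewrite add1n in yb2.
have [e1 e2] := fusion_step (Qc _) (Qc _) QP PQ Pl Pr (asymS r (ltn0Sn k)) yb1 yb2.
rewrite (asymS r (ltn0Sn k.+1)); move: (s (_ / _)) (sC (qint q k.+2 / qint q k.+3)) => c cC.
eexists; eexists; split; last by rewrite e2 mA.
by rewrite e1 mA cC -mA.
Qed.

(** For all generators but the last, the outer factors of the recursion are skew by induction. The
    last one meets the outer factor q - r that [asym_step] exhibits. *)
Lemma asym_skew k : (k <= n)%N -> skewl k (asym r k) /\ skewr k (asym r k).
Proof.
elim: k => [|[|k] ih] kn; first by split.
  by split=> [|] [|i].
have [hl hr'] := ih (ltnW kn).
have [q1 q2] := quad_baxter1 (quad (ltn0Sn k) kn).
have bq : baxter r k.+1 1 = s q - r k.+1 by rewrite /baxter bweight1.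
split=> i i0; rewrite ltnS leq_eqVlt => /orP[/eqP -> {i i0}|ik].
- case: k => [|k] in kn ih hl hr' q1 q2 bq *.
    by rewrite asymS //= mul1r mulr1 bq mulsA q1 mulsA.
  have [x [_ [-> _]]] := asym_step kn hl hr'.
  by rewrite mA bq q1 !mA.
- by rewrite asymS // mulsA (mA (r i)) (mA (r i)) hl // -!(mA (s (- q^-1))) !mA
    (sC (- q^-1)).
- case: k => [|k] in kn ih hl hr' q1 q2 bq *.
    by rewrite asymS //= mul1r mulr1 bq -mA q2 mulsA.
  have [_ [y [_ ->]]] := asym_step kn hl hr'.
  by rewrite -mA bq q2 mulsA.
- rewrite asymS // -!mA hr' // (mulsA _ (baxter _ _ _)) (mulsA _ (asym _ _)).
  exact: mulsA.
Qed.

End Relations.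

(** The product [asym r k * asym r' k] collapses to either factor. *)
Lemma asym_uniq k r r' : skewl r k (asym r' k) -> skewr r' k (asym r k) ->
  asym r k = asym r' k.
Proof. by move=> /asym_absorbl <- /asym_absorbr ->. Qed.

(** Reversal preserves the Hecke relations and the set of generators, so both elements are skew for
    the same generators and [asym_uniq] applies. *)
Lemma asym_rev n r : hecke_rel n r -> asym (fun i => r (n - i)%N) n = asym r n.
Proof.
move=> hr; have [bH fH qH] := hr.
have hr' : hecke_rel n (fun i => r (n - i)%N).
  split=> [i i0 ilt|i j i0 ij jn|i i0 ilt]; last 1 first.
  - by apply: qH; rewrite ?subn_gt0 // ltn_subrL i0 (ltn_trans i0).
  - by rewrite -subSS (subSn (ltnW ilt)) -bH //; lia.
  - by apply/esym/fH; lia.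
apply: asym_uniq => i i0 ilt.
  have [h _] := asym_skew hr (leqnn n); apply: h; lia.
have [_ h] := asym_skew hr' (leqnn n).
by rewrite -(h (n - i)%N) ?subKn //; lia.
Qed.

Lemma hecke_shift n r : hecke_rel n.+1 r -> hecke_rel n (fun i => r i.+1).
Proof.
by case=> bH fH qH; split=> *; [apply: bH|apply: fH|apply: qH].
Qed.

(** This is the recursion for the reversed generators, the last of which is [r 1]. The others are
    r_2, ..., r_n in reversed order, which [asym_rev] puts back in their usual order. *)
Lemma asym_mirror n r : hecke_rel n.+1 r -> (0 < n)%N ->
  asym r n.+1 = s (qint q n / qint q n.+1) *
    (asym (fun i => r i.+1) n * baxter r 1 n * asym (fun i => r i.+1) n).
Proof.
move=> hr n0; rewrite -(asym_rev hr) asymS // /baxter subSnn.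
suff -> : asym (fun i => r (n.+1 - i)%N) n = asym (fun i => r i.+1) n by [].
rewrite -(asym_rev (hecke_shift hr)).
by apply: eq_asym => i i0 ilt; rewrite subSn // ltnW.
Qed.

(** * Fusion and the reversal of the spectral parameters *)

Section RLL.
Variables (n : nat) (r : nat -> M) (l : nat -> nat -> M).
Hypothesis hr : hecke_rel n r.
Hypothesis rlC : forall i j a, (0 < i)%N -> (i < n)%N -> (0 < j)%N -> (j <= n)%N ->
  j != i -> j != i.+1 -> r i * l j a = l j a * r i.
Hypothesis rll : forall i a m, (0 < i)%N -> (i < n)%N -> (0 < m)%N ->
  baxter r i m * (l i a * l i.+1 (a + m)%N) = l i (a + m)%N * l i.+1 a * baxter r i m.

Fixpoint fusion k : M := if k is j.+1 then baxter r k k * fusion j else 1.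

(** The right-hand outer factor is expanded by induction; its own leading skew-symmetrizer commutes
    with the middle factor and is absorbed on the left. The constant stays implicit because
    [asym_reverse] uses it on both sides. *)
Lemma asym_fusion k : (k < n)%N ->
  exists c, asym r k.+1 = s c * (asym r k * fusion k).
Proof.
elim: k => [|k ih] kn; first by exists 1; rewrite rmorph1 !mul1r.
have [c ec] := ih (ltnW kn).
exists (qint q k.+1 / qint q k.+2 * c); rewrite asymS // {2}ec mulsA.
rewrite (mA (s _) (s c)) -rmorphM; congr (s _ * _); rewrite /= -!mA.
rewrite (mA (baxter r k.+1 k.+1) (asym r k)).
have -> : baxter r k.+1 k.+1 * asym r k = asym r k * baxter r k.+1 k.+1.
  apply/esym/asym_comm => i i0 ik; apply/esym/baxter_comm/esym.
  by have [_ h _] := hr; exact: h.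
rewrite !mA asym_absorbr // => i i0 ik.
by have [_ h] := asym_skew hr (ltnW kn); apply: h => //; exact: ltnW.
Qed.

(** The factor of weight i exchanges the parameter a, which has arrived at copy i, with a + i at
    copy i + 1; the weight is the difference of the two. Thus a travels to the last copy. *)
Lemma fusion_prod k a : (k < n)%N ->
  fusion k * \prod_(1 <= j < k.+2) l j (a + j.-1)%N
  = (\prod_(1 <= j < k.+1) l j (a + j)%N * l k.+1 a) * fusion k.
Proof.
elim: k => [|k ih] kn.
  by rewrite big_nat1 big_geq //= addn0 !mul1r mulr1.
rewrite big_nat_recr //= -mA (mA (fusion k)) ih ?(ltnW kn) //.
have comm j b m : (j <= n)%N -> (m.+1 < j)%N -> fusion m * l j b = l j b * fusion m.
  move=> jn; elim: m => [|m ihm] mj /=; first by rewrite mul1r mulr1.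
  by rewrite -mA ihm ?(ltnW mj) // mA (baxter_comm m.+1) ?mA // rlC //; lia.
rewrite -(mA _ (fusion k)) comm // [in RHS]big_nat_recr //=.
have -> : baxter r k.+1 k.+1 * (\prod_(1 <= j < k.+1) l j (a + j)%N * l k.+1 a *
    (l k.+2 (a + k.+1)%N * fusion k)) = \prod_(1 <= j < k.+1) l j (a + j)%N *
    (baxter r k.+1 k.+1 * (l k.+1 a * l k.+2 (a + k.+1)%N) * fusion k).
  rewrite !mA (prod_nat_comm (x := baxter r k.+1 k.+1)) // => j /andP[j0 jk].
  by apply: baxter_comm; apply: rlC => //; lia.
by rewrite rll // !mA.
Qed.

(** Fusion brings a to the end, and the skew-symmetrizer left in front reverses a + 1, ..., a + k.
    The induction therefore runs over all a. *)
Lemma asym_reverse k a : (k <= n)%N ->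
  asym r k * \prod_(1 <= j < k.+1) l j (a + j.-1)%N
  = \prod_(1 <= j < k.+1) l j (a + (k - j))%N * asym r k.
Proof.
elim: k a => [|k ih] a kn; first by rewrite !big_geq // mul1r mulr1.
have [c ec] := asym_fusion kn.
have cl : asym r k * l k.+1 a = l k.+1 a * asym r k.
  by apply: asym_comm => i i0 ik; apply: rlC => //; lia.
have e1 : asym r k * \prod_(1 <= j < k.+1) l j (a + j)%N
    = \prod_(1 <= j < k.+1) l j (a + (k.+1 - j))%N * asym r k.
  have e F : \prod_(1 <= j < k.+1) l j (a + j)%N = F ->
      \prod_(1 <= j < k.+1) l j (a.+1 + j.-1)%N = F.
    by move=> <-; apply: eq_big_nat => -[|j] // _; rewrite addSnnS.
  rewrite -(e _ (erefl _)) ih ?(ltnW kn) //; congr (_ * _).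
  by apply: eq_big_nat => j /andP[_ jk]; rewrite addSnnS subSn.
rewrite [in RHS]big_nat_recr //= subnn addn0 {2}ec ec mulsA -(mA (s c)).
by congr (s c * _); rewrite -mA fusion_prod // !mA e1 -(mA _ (asym r k)) cl !mA.
Qed.

End RLL.
End SkewSymmetrizer.

(* Conjugation by [\prod_(1 <= j < n) r j] shifts the generators [r i] and the copies
   [l i] by one factor. *)
Section BraidShift.
Variables (K : fieldType) (q : K) (M : pzRingType) (s : {rmorphism K -> M}).
Hypothesis sC : forall c x, s c * x = x * s c.
Variables (n : nat) (r rV : nat -> M) (l : nat -> nat -> M).
Hypothesis hr : hecke_rel q s n r.
Hypothesis rK : forall i, (0 < i)%N -> (i < n)%N -> r i * rV i = 1.
Hypothesis Kr : forall i, (0 < i)%N -> (i < n)%N -> rV i * r i = 1.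
Hypothesis lS : forall j a, (0 < j)%N -> (j < n)%N -> l j.+1 a = r j * l j a * rV j.
Hypothesis rl1 : forall i a, (1 < i)%N -> (i < n)%N -> r i * l 1 a = l 1 a * r i.

Let braid i : (0 < i)%N -> (i.+1 < n)%N -> r i * r i.+1 * r i = r i.+1 * r i * r i.+1.
Proof. by case: hr => h _ _; exact: h. Qed.
Let far i j : (0 < i)%N -> (i < n)%N -> (0 < j)%N -> (j < n)%N ->
  (i.+1 < j)%N || (j.+1 < i)%N -> r i * r j = r j * r i.
Proof.
by case: hr => _ h _ i0 ilt j0 jn /orP[]?; [|apply/esym]; exact: h.
Qed.

Lemma conj_inv (w wV x y : M) : w * wV = 1 -> wV * w = 1 -> x * w = w * y ->
  wV * x = y * wV.
Proof. by move=> wK Kw e; rewrite -[x]mulr1 -wK (mulrA x) e !mulrA Kw mul1r. Qed.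

Lemma comm_inv i x : (0 < i)%N -> (i < n)%N -> x * r i = r i * x -> x * rV i = rV i * x.
Proof.
move=> i0 ilt e; rewrite -[x in LHS]mul1r -(Kr i0 ilt) -!mulrA (mulrA (r i)) -e.
by rewrite -!mulrA rK // mulr1.
Qed.

(** Beyond far commutation there is one case, i = j - 2: moving through the word r_(i+1) r_i, the
    generator r_i becomes r_(i+1), which commutes with copy i by induction, and the inverse word
    turns it back into r_i. *)
Lemma r_l_comm i j a : (0 < i)%N -> (i < n)%N -> (0 < j)%N -> (j <= n)%N ->
  j != i -> j != i.+1 -> r i * l j a = l j a * r i.
Proof.
elim/ltn_ind: j i => -[//|[|j]] ih i i0 ilt _ jn ji ji1.
  by apply: rl1 => //; lia.
have rjC : (i.+1 < j.+1)%N || (j.+2 < i)%N -> r i * l j.+2 a = l j.+2 a * r i.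
  move=> hij; have cr : r i * r j.+1 = r j.+1 * r i by apply: far => //; lia.
  rewrite lS // -!mulrA -(comm_inv _ _ cr) // !mulrA; congr (_ * _).
  by rewrite cr -!mulrA ih //; lia.
case: (ltngtP i j) => [h|h|e]; [by apply: rjC; rewrite ltnS h|by apply: rjC; lia|].
subst i; case: j => [//|j] in ih jn i0 ilt ji ji1 rjC *.
(* The braid relation as it reads on the inverse word to the right of the copy. *)
have e1 : rV j.+1 * rV j.+2 * r j.+1 = r j.+2 * (rV j.+1 * rV j.+2).
  have wK : r j.+2 * r j.+1 * (rV j.+1 * rV j.+2) = 1.
    by rewrite -!mulrA (mulrA (r j.+1)) rK // mul1r rK.
  have Kw : rV j.+1 * rV j.+2 * (r j.+2 * r j.+1) = 1.
    by rewrite -!mulrA (mulrA (rV j.+2)) Kr // mul1r Kr.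
  apply: (conj_inv wK Kw); rewrite mulrA braid // -!mulrA; congr (_ * _).
rewrite (lS (j := j.+2)) // (lS (j := j.+1)) // !mulrA braid // -!mulrA;
  congr (_ * (_ * _)).
rewrite (mulrA (rV _)) e1 !mulrA ih //; lia.
Qed.

Lemma prod_r_inv k : (k <= n)%N ->
  exists y, (\prod_(1 <= j < k) r j * y = 1) /\ (y * \prod_(1 <= j < k) r j = 1).
Proof.
elim: k => [|[|k] ih] kn; try by exists 1; rewrite !big_geq // !mulr1.
have [y [e1 e2]] := ih (ltnW kn); exists (rV k.+1 * y); rewrite big_nat_recr //=.
split; first by rewrite -!mulrA (mulrA (r _)) rK ?mul1r.
by rewrite -!mulrA (mulrA y) e2 mul1r Kr.
Qed.

(** From the right, r_i passes the letters above r_(i+1), becomes r_(i+1) by the braid relation, and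
    passes the letters below r_i. *)
Lemma shift_r k i : (k <= n)%N -> (0 < i)%N -> (i.+1 < k)%N ->
  \prod_(1 <= j < k) r j * r i = r i.+1 * \prod_(1 <= j < k) r j.
Proof.
elim: k => [//|k ih] kn i0; rewrite ltnS leq_eqVlt => /orP[/eqP e|ik]; last first.
  rewrite big_nat_recr ?(ltn_trans _ ik) //= -mulrA (far (i := k)) //; [|lia..].
  by rewrite !mulrA ih // ltnW.
rewrite -{k}e in ih kn *; rewrite !big_nat_recr //= -!mulrA (mulrA (r i)) braid //.
rewrite !mulrA; congr (_ * _ * _); apply/esym/prod_nat_comm => j /andP[j0 ji].
by apply: far => //; lia.
Qed.

Lemma shift_l k i a : (k <= n)%N -> (0 < i)%N -> (i < k)%N ->
  \prod_(1 <= j < k) r j * l i a = l i.+1 a * \prod_(1 <= j < k) r j.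
Proof.
elim: k => [//|k ih] kn i0; rewrite ltnS leq_eqVlt => /orP[/eqP e|ik]; last first.
  rewrite big_nat_recr ?(leq_ltn_trans _ ik) //= -mulrA r_l_comm //; [|lia..].
  by rewrite !mulrA ih // ltnW.
rewrite -{k}e in ih kn *; rewrite big_nat_recr //= -!mulrA.
have -> : r i * l i a = l i.+1 a * r i by rewrite lS // -!mulrA Kr // mulr1.
rewrite !mulrA; congr (_ * _); apply/esym/prod_nat_comm => j /andP[j0 ji].
by apply/esym/r_l_comm => //; lia.
Qed.

Lemma rll_shift a b m : (1 < n)%N ->
  baxter q s r 1 m * (l 1 a * l 2 b) = l 1 b * l 2 a * baxter q s r 1 m ->
  forall i, (0 < i)%N -> (i < n)%N ->
  baxter q s r i m * (l i a * l i.+1 b) = l i b * l i.+1 a * baxter q s r i m.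
Proof.
move=> n1 e1; elim=> [//|[|i] ih] _ ilt //.
have {}ih := ih isT (ltnW ilt).
have [y [zK _]] := prod_r_inv (leqnn n).
have sb : \prod_(1 <= j < n) r j * baxter q s r i.+1 m
    = baxter q s r i.+2 m * \prod_(1 <= j < n) r j.
  by rewrite mulrBr mulrBl sC shift_r.
have sl j c : (0 < j)%N -> (j < n)%N ->
   \prod_(1 <= j < n) r j * l j c = l j.+1 c * \prod_(1 <= j < n) r j.
  by move=> *; exact: shift_l.
move: (\prod_(1 <= j < n) r j) => z in zK sb sl *.
rewrite -[LHS]mulr1 -[RHS]mulr1 -zK !mulrA; congr (_ * y).
rewrite -!mulrA -sl ?(ltnW ilt) // (mulrA (l _ _)) -sl ?(ltnW ilt) //.
rewrite -sb -(mulrA z) mulrA -sb -mulrA ih !mulrA.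
by rewrite sl ?(ltnW ilt) // -!mulrA (mulrA z) sl // -!mulrA.
Qed.

End BraidShift.

(** * Operators on tensor powers *)

Section TensorEntries.
Variables (A : pzSemiRingType) (N : nat).

Lemma tentryE n (f : midx N n -> midx N n -> A) a b : tentry (tmatrix f) a b = f a b.
Proof. by rewrite /tentry mxE !enum_rankK. Qed.

Lemma tentryP n (X Y : 'M[A]_#|midx N n|) :
  (forall a b, tentry X a b = tentry Y a b) -> X = Y.
Proof.
by move=> h; apply/matrixP=> i j; have := h (enum_val i) (enum_val j);
   rewrite /tentry !enum_valK.
Qed.

Lemma tentryM n (X Y : 'M[A]_#|midx N n|) a b :
  tentry (X *m Y) a b = \sum_c tentry X a c * tentry Y c b.
Proof.
rewrite /tentry mxE (reindex enum_rank) //=.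
by exists enum_val => x _; rewrite ?enum_rankK ?enum_valK.
Qed.

Lemma tentry_scalar n (c : A) (a b : midx N n) : tentry (c%:M) a b = c *+ (a == b).
Proof. by rewrite /tentry mxE (inj_eq enum_rank_inj). Qed.

Lemma sum_midx2 (V : nmodType) (F : midx N 2 -> V) :
  \sum_c F c = \sum_i \sum_j F (pair_idx i j).
Proof.
rewrite pair_big /= (reindex (fun p : 'I_N * 'I_N => pair_idx p.1 p.2)) //=.
exists (fun c : midx N 2 => (c ord0, c ord_max)) => [[i j] _|c _] /=.
  by rewrite !ffunE.
apply/ffunP => t; rewrite ffunE; case: eqP => [-> //|/eqP h]; congr (c _).
by apply: val_inj; case: t h => -[|[|]].
Qed.

Lemma entry2M (X Y : 'M[A]_#|midx N 2|) (i j k l : 'I_N) :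
  entry2 (X *m Y) i j k l = \sum_x \sum_y entry2 X i j x y * entry2 Y x y k l.
Proof. by rewrite /entry2 tentryM sum_midx2. Qed.

Lemma entry2_scalar (c : A) (i j k l : 'I_N) :
  entry2 (c%:M) i j k l = c *+ ((i == k) && (j == l)) :> A.
Proof.
rewrite /entry2 tentry_scalar; congr (_ *+ nat_of_bool _).
apply/eqP/andP => [/ffunP h|[/eqP -> /eqP ->] //].
by have := (h ord0, h ord_max); rewrite !ffunE /= => -[-> ->].
Qed.

Section AtPos.
Variables (p d : nat) (s : 'I_p.+1 -> 'I_d.+1).

Definition restr (a : midx N d.+1) : midx N p.+1 := [ffun t => a (s t)].

Definition agree (a b : midx N d.+1) := [forall t, (t \notin codom s) ==> (a t == b t)].

(* [X] acting in the factors [s 0], ..., [s p] (counted from 0). *)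
Definition at_pos (X : 'M[A]_#|midx N p.+1|) : 'M[A]_#|midx N d.+1| :=
  tmatrix (fun a b => tentry X (restr a) (restr b) *+ agree a b).

Definition upd (a : midx N d.+1) (c : midx N p.+1) : midx N d.+1 :=
  [ffun t => if [pick i | s i == t] is Some i then c i else a t].

Hypothesis s_inj : injective s.

Lemma restr_upd a c : restr (upd a c) = c.
Proof.
apply/ffunP => t; rewrite !ffunE; case: pickP => [i /eqP/s_inj -> //|/(_ t)].
by rewrite eqxx.
Qed.

Lemma upd_off a c t : t \notin codom s -> upd a c t = a t.
Proof.
by move=> h; rewrite ffunE; case: pickP => [i /eqP e|//]; rewrite -e codom_f in h.
Qed.

Lemma agreeP (a b : midx N d.+1) : reflect (forall t, t \notin codom s ->
  a t = b t) (agree a b).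
Proof.
apply: (iffP forallP) => h t; first by move=> ht; apply/eqP; apply: (implyP (h t)).
by apply/implyP => /h ->.
Qed.

Lemma agree_refl a : agree a a. Proof. exact/agreeP. Qed.

Lemma agree_updl a c b : agree (upd a c) b = agree a b.
Proof. by apply/agreeP/agreeP => h t ht; rewrite -h ?upd_off. Qed.

Lemma agree_updr a c b : agree b (upd a c) = agree b a.
Proof. by apply/agreeP/agreeP => h t ht; rewrite h ?upd_off. Qed.

Lemma upd_restr a b : agree a b -> upd a (restr b) = b.
Proof.
move/agreeP => h; apply/ffunP => t; rewrite ffunE.
case: pickP => [i /eqP <-|nt]; first by rewrite ffunE.
by apply: h; apply/codomP => -[i e]; have := nt i; rewrite e eqxx.
Qed.

Lemma sum_agree (V : nmodType) a (F : midx N d.+1 -> V) :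
  \sum_(e | agree a e) F e = \sum_c F (upd a c).
Proof.
rewrite (reindex_onto (upd a) restr) /=; last by move=> e; exact: upd_restr.
by apply: eq_bigl => c; rewrite agree_updr agree_refl restr_upd eqxx.
Qed.

Lemma agree_sym a b : agree a b = agree b a.
Proof. by apply/agreeP/agreeP => h t ht; rewrite h. Qed.

Lemma at_posMl X (Y : 'M[A]_#|midx N d.+1|) a b :
  tentry (at_pos X *m Y) a b = \sum_c tentry X (restr a) c * tentry Y (upd a c) b.
Proof.
rewrite tentryM (bigID (agree a)) /= [X in _ + X]big1 ?addr0 => [|e /negbTE h].
  rewrite (eq_bigr (fun e => tentry X (restr a) (restr e) * tentry Y e b)).
    by rewrite sum_agree; apply: eq_bigr => c _; rewrite restr_upd.
  by move=> e h; rewrite tentryE h.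
by rewrite tentryE h mul0r.
Qed.

Lemma at_posMr X (Y : 'M[A]_#|midx N d.+1|) a b :
  tentry (Y *m at_pos X) a b = \sum_c tentry Y a (upd b c) * tentry X c (restr b).
Proof.
rewrite tentryM (bigID (agree b)) /= [X in _ + X]big1 ?addr0 => [|e /negbTE h].
  rewrite (eq_bigr (fun e => tentry Y a e * tentry X (restr e) (restr b))).
    by rewrite sum_agree; apply: eq_bigr => c _; rewrite restr_upd.
  by move=> e h; rewrite tentryE agree_sym h.
by rewrite tentryE agree_sym h mulr0.
Qed.

Lemma at_posM X Y : at_pos (X *m Y) = at_pos X *m at_pos Y.
Proof.
apply: tentryP => a b; rewrite at_posMl tentryE tentryM -sumrMnl.
by apply: eq_bigr => c _; rewrite tentryE restr_upd agree_updl mulrnAr.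
Qed.

Lemma at_pos_scalar (c : A) : at_pos c%:M = c%:M.
Proof.
apply: tentryP => a b; rewrite tentryE !tentry_scalar -mulrnA mulnb.
congr (_ *+ nat_of_bool _); apply/andP/eqP => [[/eqP e h]|-> //].
  by rewrite -(upd_restr h) -e upd_restr ?agree_refl.
by rewrite eqxx agree_refl.
Qed.

End AtPos.

Lemma eq_at_pos p d (s s' : 'I_p.+1 -> 'I_d.+1) X : s =1 s' -> at_pos s X = at_pos s' X.
Proof.
move=> e; apply: tentryP => a b; rewrite !tentryE.
have er c : restr s c = restr s' c by apply/ffunP => t; rewrite !ffunE e.
rewrite !er; congr (_ *+ nat_of_bool _).
by apply: eq_forallb => t; rewrite (eq_codom e).
Qed.

Lemma at_pos_comp p d e (s : 'I_p.+1 -> 'I_d.+1) (t : 'I_d.+1 -> 'I_e.+1) X :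
  injective t -> at_pos t (at_pos s X) = at_pos (t \o s) X.
Proof.
move=> ti; apply: tentryP => a b; rewrite !tentryE.
have er c : restr s (restr t c) = restr (t \o s) c by apply/ffunP => i; rewrite !ffunE.
rewrite !er -mulrnA mulnb; congr (_ *+ nat_of_bool _).
apply/andP/agreeP => [[/agreeP h1 /agreeP h2] i hi|h].
  have [/codomP [j ej]|/h2 //] := boolP (i \in codom t).
  have := h1 j; rewrite !ffunE -ej; apply; apply: contraNN hi => /codomP [k ek].
  by apply/codomP; exists k; rewrite ej ek.
split; apply/agreeP => i hi; rewrite ?ffunE; apply: h.
  by apply: contraNN hi => /codomP [k /ti ->]; exact: codom_f.
by apply: contraNN hi => /codomP [k ->]; exact: codom_f.
Qed.

(** On either side a single intermediate multi-index survives. The hypothesis on entries replaces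
    commutativity of the base ring; it is applied when at least one matrix has central entries. *)
Lemma at_pos_comm p p' d (s : 'I_p.+1 -> 'I_d.+1) (s' : 'I_p'.+1 -> 'I_d.+1) X Y :
  injective s -> injective s' -> (forall i j, s i != s' j) ->
  (forall a b a' b', tentry X a b * tentry Y a' b' = tentry Y a' b' * tentry X a b) ->
  at_pos s X *m at_pos s' Y = at_pos s' Y *m at_pos s X.
Proof.
move=> si si' dis c; apply: tentryP => a b.
rewrite at_posMl // at_posMr //.
rewrite (bigD1 (restr s b)) //= big1 ?addr0 => [|e /negbTE he]; last first.
  rewrite tentryE; case: agreeP => [h|]; last by rewrite mulr0.
  case/eqP: he; apply/ffunP => t; have := h (s t).
  rewrite !ffunE; case: pickP => [i /eqP/si -> ->//|/(_ t)]; last by rewrite eqxx.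
  by apply/codomP => -[j /eqP e']; move: e'; rewrite (negbTE (dis _ _)).
rewrite [RHS](bigD1 (restr s a)) //= big1 ?addr0 => [|e /negbTE he]; last first.
  rewrite tentryE; case: agreeP => [h|]; last by rewrite mul0r.
  case/eqP: he; apply/ffunP => t; have := h (s t).
  rewrite !ffunE; case: pickP => [i /eqP/si -> <-//|/(_ t)]; last by rewrite eqxx.
  by apply/codomP => -[j /eqP e']; move: e'; rewrite (negbTE (dis _ _)).
have off u x : restr s' (upd s u x) = restr s' u.
  apply/ffunP => t; rewrite !ffunE; case: pickP => [i /eqP e|//].
  by move/eqP: (dis i t); rewrite e.
rewrite !tentryE !off mulrnAr mulrnAl c; congr (_ *+ nat_of_bool _).
apply/agreeP/agreeP => h t ht; have := h t ht; rewrite !ffunE;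
  by case: pickP => [i /eqP e|//]; rewrite ?ffunE e.
Qed.

End TensorEntries.

Lemma map_at_pos (A B : pzSemiRingType) (f : {rmorphism A -> B}) N p d
    (s : 'I_p.+1 -> 'I_d.+1) (X : 'M[A]_#|midx N p.+1|) :
  map_mx f (at_pos s X) = at_pos s (map_mx f X).
Proof.
by apply: tentryP => a b; rewrite [RHS]tentryE /tentry !mxE !enum_rankK rmorphMn.
Qed.

Lemma at_posD (A : pzRingType) N p d (s : 'I_p.+1 -> 'I_d.+1)
    (X Y : 'M[A]_#|midx N p.+1|) : at_pos s (X + Y) = at_pos s X + at_pos s Y.
Proof.
by apply: tentryP => a b; rewrite tentryE /tentry !mxE !enum_rankK mulrnDl.
Qed.

Lemma at_posN (A : pzRingType) N p d (s : 'I_p.+1 -> 'I_d.+1)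
    (X : 'M[A]_#|midx N p.+1|) : at_pos s (- X) = - at_pos s X.
Proof.
by apply: tentryP => a b; rewrite tentryE /tentry !mxE !enum_rankK mulNrn.
Qed.

Section Positions.
Variables (A : pzSemiRingType) (N : nat).

Definition pos2 d k (t : 'I_2) : 'I_d.+1 :=
  if t == ord0 then tfactor d.+1 k else tfactor d.+1 k.+1.

Lemma pos2E d k t : (0 < k)%N -> (k < d.+1)%N -> pos2 d k t = (k.-1 + t)%N :> nat.
Proof.
move=> k0 kd; rewrite /pos2 /tfactor; case: eqP => [->|] /=.
  by rewrite inordK ?addn0 //; lia.
case: t => -[|[|]] //= h e; first by case: e; exact: val_inj.
by rewrite inordK; lia.
Qed.

Lemma pos2_inj d k : (0 < k)%N -> (k < d.+1)%N -> injective (pos2 d k).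
Proof.
move=> k0 kd i j /(congr1 val); rewrite /= !pos2E // => /addnI e; exact: val_inj.
Qed.

Lemma pair_restr d k (a : midx N d.+1) :
  pair_idx (a (tfactor d.+1 k)) (a (tfactor d.+1 k.+1)) = restr (pos2 d k) a.
Proof. by apply/ffunP => t; rewrite !ffunE /pos2; case: eqP. Qed.

Lemma at_factorsE d k (X : 'M[A]_#|midx N 2|) :
  at_factors d.+1 k X = at_pos (pos2 d k) X.
Proof.
apply: tentryP => a b; rewrite !tentryE /entry2 !pair_restr.
congr (_ *+ nat_of_bool _); apply: eq_forallb => t.
have -> : (t \notin codom (pos2 d k))
    = (t != tfactor d.+1 k) && (t != tfactor d.+1 k.+1).
  apply/idP/andP => [h|[h1 h2]].
    split; apply: contraNN h => /eqP ->; apply/codomP; first by exists ord0.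
    by exists ord_max.
  apply/codomP => -[j ej]; move: ej; rewrite /pos2; case: ifP => _ e;
    first by rewrite e eqxx in h1.
  by rewrite e eqxx in h2.
by case: (_ != _); case: (_ != _).
Qed.

Definition mat1 (X : 'M[A]_N) : 'M[A]_#|midx N 1| :=
  tmatrix (fun a b => X (a ord0) (b ord0)).

Definition pos1 d (_ : 'I_1) : 'I_d.+1 := tfactor d.+1 1.

Lemma pos1_inj d : injective (pos1 d).
Proof. by move=> i j _; rewrite !ord1. Qed.

Lemma at_firstE d X : at_first d.+1 X = at_pos (pos1 d) (mat1 X).
Proof.
apply: tentryP => a b; rewrite !tentryE !ffunE /pos1.
congr (_ *+ nat_of_bool _); apply: eq_forallb => t.
suff -> : (t \notin codom (pos1 d)) = (t != tfactor d.+1 1) by [].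
congr negb; apply/codomP/eqP => [[j ->] //|->].
by exists ord0.
Qed.

Definition widen d : 'I_d.+1 -> 'I_d.+2 := widen_ord (leqnSn d.+1).

Lemma widen_inj d : injective (@widen d).
Proof. by move=> i j /(congr1 val) /= e; exact: val_inj. Qed.

Definition emb d (X : 'M[A]_#|midx N d.+1|) : 'M[A]_#|midx N d.+2| :=
  at_pos (@widen d) X.

Lemma embM d X Y : @emb d (X *m Y) = emb X *m emb Y.
Proof. exact/at_posM/widen_inj. Qed.

Lemma emb_scalar d c : @emb d c%:M = c%:M.
Proof. exact: at_pos_scalar. Qed.

Lemma emb_factors d k X : (0 < k)%N -> (k < d.+1)%N ->
  emb (at_factors d.+1 k X) = at_factors d.+2 k X.
Proof.
move=> k0 kd; rewrite !at_factorsE /emb at_pos_comp; last exact: widen_inj.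
by apply: eq_at_pos => t; apply: val_inj; rewrite /= !pos2E //; lia.
Qed.

Lemma emb_first d X : emb (at_first d.+1 X) = at_first d.+2 X.
Proof.
rewrite !at_firstE /emb at_pos_comp; last exact: widen_inj.
by apply: eq_at_pos => t; apply: val_inj; rewrite /= /pos1 /tfactor !inordK.
Qed.

(** These positions carry the braid relation, which is given in three factors, to an arbitrary
    tensor power. *)
Definition pos3 d i (t : 'I_3) : 'I_d.+1 := inord (i.-1 + t).

Lemma pos3E d i t : (i.-1.+2 < d.+1)%N -> pos3 d i t = (i.-1 + t)%N :> nat.
Proof. by move=> h; rewrite inordK //; case: t => t /= ht; lia. Qed.

Lemma pos3_inj d i : (i.-1.+2 < d.+1)%N -> injective (pos3 d i).
Proof.
move=> h j k /(congr1 val); rewrite /= !pos3E // => /addnI; exact: val_inj.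
Qed.

Lemma pos3_factors d i (X : 'M[A]_#|midx N 2|) : (0 < i)%N -> (i.+1 < d.+1)%N ->
  at_pos (pos3 d i) (at_factors 3 1 X) = at_factors d.+1 i X /\
  at_pos (pos3 d i) (at_factors 3 2 X) = at_factors d.+1 i.+1 X.
Proof.
move=> i0 id; have h3 : (i.-1.+2 < d.+1)%N by rewrite prednK.
split; rewrite !at_factorsE at_pos_comp; try (exact: pos3_inj);
  apply: eq_at_pos => t; apply: val_inj; rewrite /= pos3E // !pos2E //; lia.
Qed.

End Positions.

Section FactorsHecke.
Variables (K : fieldType) (N : nat) (R : 'M[K]_#|midx N 2|) (q : K).
Hypothesis hR : hecke_symmetry R q.

Lemma at_factors_hecke d :
  hecke_rel q (@scalar_mx K #|midx N d.+1|) d.+1 (fun i => at_factors d.+1 i R).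
Proof.
have [hb hq] := hR; split=> [i i0 id|i j i0 ij jd|i i0 id].
- have [e1 e2] := pos3_factors R i0 id; rewrite -e1 -e2 -!mulmxE.
  have si : injective (pos3 d i) by apply: pos3_inj; rewrite prednK.
  by rewrite -!at_posM // hb.
- rewrite !at_factorsE -!mulmxE; apply: at_pos_comm.
  + by apply: pos2_inj => //; lia.
  + by apply: pos2_inj => //; lia.
  + move=> t t'; apply/eqP => /(congr1 val); rewrite /= !pos2E //; try lia.
    by case: t => t ht; case: t' => t' ht' /=; lia.
  + by move=> *; rewrite mulrC.
- have si : injective (pos2 d i) by apply: pos2_inj.
  transitivity ((q%:M - at_factors d.+1 i R) *m (q^-1%:M + at_factors d.+1 i R)) => //.
  rewrite !at_factorsE -!(at_pos_scalar N (pos2 d i)) -at_posN -!at_posD.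
  rewrite -at_posM // hq; apply: tentryP => a b.
  by rewrite tentryE /tentry !mxE mul0rn.
Qed.

End FactorsHecke.

(** * Appending a tensor factor and tracing it out *)

Section Extension.
Variable N : nat.

Lemma widen_case d (t : 'I_d.+2) : {u | t = widen u} + {t = ord_max}.
Proof.
case: (unliftP ord_max t) => [u ->|->]; last by right.
by left; exists u; apply/val_inj/lift_max.
Qed.

Definition ext d (a : midx N d.+1) (j : 'I_N) : midx N d.+2 :=
  [ffun t => if unlift ord_max t is Some u then a u else j].

Lemma ext_max d (a : midx N d.+1) j : ext a j ord_max = j.
Proof. by rewrite ffunE unlift_none. Qed.

Lemma ext_widen d (a : midx N d.+1) j t : ext a j (widen t) = a t.
Proof.
have -> : widen t = lift ord_max t by apply/val_inj/esym/lift_max.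
by rewrite ffunE liftK.
Qed.

Lemma sum_ext d (V : nmodType) (F : midx N d.+2 -> V) :
  \sum_e F e = \sum_a \sum_j F (ext a j).
Proof.
rewrite pair_big /=.
rewrite (reindex (fun p : midx N d.+1 * 'I_N => ext p.1 p.2)) //=.
exists (fun e : midx N d.+2 => (restr (@widen d) e, e ord_max)) => [[a j] _|e _] /=.
  by rewrite ext_max; congr pair; apply/ffunP => t; rewrite ffunE ext_widen.
apply/ffunP => t; have [[u ->]|->] := widen_case t; last by rewrite ext_max.
by rewrite ext_widen ffunE.
Qed.

Lemma eq_ext d (a b : midx N d.+1) i j : (ext a i == ext b j) = (a == b) && (i == j).
Proof.
apply/eqP/andP => [/ffunP h|[/eqP -> /eqP ->] //].
split; last by have := h ord_max; rewrite !ext_max => ->.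
by apply/eqP/ffunP => t; have := h (widen t); rewrite !ext_widen.
Qed.

Definition setl d (a : midx N d.+1) (x : 'I_N) : midx N d.+1 :=
  [ffun t => if t == ord_max then x else a t].

Lemma setl_ext d (a : midx N d.+1) i x : setl (ext a i) x = ext a x.
Proof.
apply/ffunP => t; rewrite ffunE; have [[u ->]|->] := widen_case t.
  by rewrite !ext_widen -val_eqE /= ltn_eqF.
by rewrite eqxx ext_max.
Qed.

Lemma tfactor_widen d : tfactor d.+2 d.+1 = widen (@ord_max d).
Proof. by apply: val_inj; rewrite /= inordK. Qed.

Lemma tfactor_max d : tfactor d.+1 d.+1 = @ord_max d.
Proof. by apply: val_inj; rewrite /= inordK. Qed.

Lemma restr_last d (a : midx N d.+1) j :
  restr (pos2 d.+1 d.+1) (ext a j) = pair_idx (a ord_max) j.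
Proof. by rewrite -pair_restr tfactor_widen tfactor_max ext_widen ext_max. Qed.

Lemma upd_last d (a : midx N d.+1) j x y :
  upd (pos2 d.+1 d.+1) (ext a j) (pair_idx x y) = ext (setl a x) y.
Proof.
have <- : restr (pos2 d.+1 d.+1) (ext (setl a x) y) = pair_idx x y.
  by rewrite restr_last ffunE eqxx.
apply: upd_restr; apply/agreeP => t ht.
have [[u e]|e] := widen_case t; last first.
  by case/codomP: ht; exists ord_max; rewrite e /pos2 /= tfactor_max.
rewrite e !ext_widen ffunE; case: eqP => // eu.
by case/codomP: ht; exists ord0; rewrite e /pos2 /= tfactor_widen eu.
Qed.

Lemma restr_widen d (a : midx N d.+1) j : restr (@widen d) (ext a j) = a.
Proof. by apply/ffunP => t; rewrite ffunE ext_widen. Qed.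

Lemma upd_widen d (a b : midx N d.+1) j : upd (@widen d) (ext a j) b = ext b j.
Proof.
rewrite -{1}(restr_widen b j); apply: upd_restr.
apply/agreeP => t ht; have [[u e]|->] := widen_case t; last by rewrite !ext_max.
by case/codomP: ht; exists u.
Qed.

Variable A : pzSemiRingType.

Lemma pos2_last_inj d : injective (pos2 d.+1 d.+1).
Proof. exact: pos2_inj. Qed.

Lemma lastMl d X (Y : 'M[A]_#|midx N d.+2|) (a : midx N d.+1) j c :
  tentry (at_factors d.+2 d.+1 X *m Y) (ext a j) c
  = \sum_x \sum_y entry2 X (a ord_max) j x y * tentry Y (ext (setl a x) y) c.
Proof.
rewrite at_factorsE at_posMl; last exact: pos2_last_inj.
rewrite sum_midx2; apply: eq_bigr => x _; apply: eq_bigr => y _.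
by rewrite restr_last upd_last.
Qed.

Lemma lastMr d X (Y : 'M[A]_#|midx N d.+2|) (b : midx N d.+1) i c :
  tentry (Y *m at_factors d.+2 d.+1 X) c (ext b i)
  = \sum_x \sum_y tentry Y c (ext (setl b x) y) * entry2 X x y (b ord_max) i.
Proof.
rewrite at_factorsE at_posMr; last exact: pos2_last_inj.
rewrite sum_midx2; apply: eq_bigr => x _; apply: eq_bigr => y _.
by rewrite restr_last upd_last.
Qed.

Lemma embMl d (X : 'M[A]_#|midx N d.+1|) Y a j c :
  tentry (emb X *m Y) (ext a j) c = \sum_e tentry X a e * tentry Y (ext e j) c.
Proof.
rewrite /emb at_posMl; last exact: widen_inj.
by rewrite restr_widen; apply: eq_bigr => e _; rewrite upd_widen.
Qed.

Lemma embMr d (X : 'M[A]_#|midx N d.+1|) Y b i c :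
  tentry (Y *m emb X) c (ext b i) = \sum_e tentry Y c (ext e i) * tentry X e b.
Proof.
rewrite /emb at_posMr; last exact: widen_inj.
by rewrite restr_widen; apply: eq_bigr => e _; rewrite upd_widen.
Qed.

Lemma emb_entry d (X : 'M[A]_#|midx N d.+1|) a b i j :
  tentry (emb X) (ext a i) (ext b j) = tentry X a b *+ (i == j).
Proof.
rewrite -[emb X]mulmx1 embMl (bigD1 b) //= big1 => [|e he].
  by rewrite tentry_scalar eq_ext eqxx addr0 mulr_natr.
by rewrite tentry_scalar eq_ext (negbTE he) mulr0n mulr0.
Qed.

End Extension.

Section PartialTrace.
Variables (K : fieldType) (N : nat) (C : 'M[K]_N) (B : algType K).

Local Notation lift := (map_mx (in_alg B)).

(* The R-trace over the last of d+2 factors. *)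
Definition ptr d (X : 'M[B]_#|midx N d.+2|) : 'M[B]_#|midx N d.+1| :=
  tmatrix (fun a b => \sum_i \sum_j C i j *: tentry X (ext a j) (ext b i)).

Lemma ptr_embl d X Y : @ptr d (emb X *m Y) = X *m ptr Y.
Proof.
apply: tentryP => a b; rewrite tentryE tentryM.
under eq_bigr => i _ do under eq_bigr => j _ do rewrite embMl scaler_sumr.
under [RHS]eq_bigr => e _ do rewrite tentryE mulr_sumr.
rewrite [RHS]exchange_big; apply: eq_bigr => i _.
under [RHS]eq_bigr => e _ do rewrite mulr_sumr.
rewrite [RHS]exchange_big; apply: eq_bigr => j _; apply: eq_bigr => e _.
by rewrite scalerAr.
Qed.

Lemma ptr_embr d X Y : @ptr d (Y *m emb X) = ptr Y *m X.
Proof.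
apply: tentryP => a b; rewrite tentryE tentryM.
under eq_bigr => i _ do under eq_bigr => j _ do rewrite embMr scaler_sumr.
under [RHS]eq_bigr => e _ do rewrite tentryE mulr_suml.
rewrite [RHS]exchange_big; apply: eq_bigr => i _.
under [RHS]eq_bigr => e _ do rewrite mulr_suml.
rewrite [RHS]exchange_big; apply: eq_bigr => j _; apply: eq_bigr => e _.
by rewrite scalerAl.
Qed.

Lemma rtrace_ptr d X : rtrace C (n := d.+2) X = rtrace C (ptr X).
Proof.
rewrite /rtrace sum_ext; apply: eq_bigr => a _.
under eq_bigr => j _ do rewrite sum_ext.
rewrite exchange_big; apply: eq_bigr => b _.
rewrite tentryE scaler_sumr; apply: eq_bigr => i _.
rewrite scaler_sumr; apply: eq_bigr => j _; rewrite scalerA; congr (_ *: _).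
rewrite big_ord_recr /= !ext_max; congr (_ * _); apply: eq_bigr => t _.
by rewrite !ext_widen.
Qed.

Lemma ext_first d (a : midx N d.+1) j : ext a j (tfactor d.+2 1) = a (tfactor d.+1 1).
Proof.
rewrite -(ext_widen a j); congr (ext _ _ _); apply: val_inj.
by rewrite /= /tfactor !inordK.
Qed.

Lemma rtrace_tail_ptr d X : rtrace_tail C (n := d.+2) X = rtrace_tail C (ptr X).
Proof.
apply/matrixP => i j; rewrite !mxE.
rewrite big_mkcond sum_ext /= [RHS]big_mkcond; apply: eq_bigr => a _.
under eq_bigr => x _ do rewrite ext_first.
case: ifP => _; last by rewrite big1.
under eq_bigr => x _ do rewrite big_mkcond sum_ext /=.
rewrite exchange_big [RHS]big_mkcond; apply: eq_bigr => b _.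
under eq_bigr => x _ do under eq_bigr => y _ do rewrite ext_first.
case: ifP => _; last by rewrite big1 // => x _; rewrite big1.
rewrite tentryE scaler_sumr; apply: eq_bigr => x _.
rewrite scaler_sumr; apply: eq_bigr => y _; rewrite scalerA; congr (_ *: _).
rewrite big_mkcond big_ord_recr /= !ext_max; congr (_ * _).
  rewrite [RHS]big_mkcond; apply: eq_bigr => t _.
  rewrite -[widen_ord _ t]/(widen t) !ext_widen.
  have -> // : (widen t != tfactor d.+2 1) = (t != tfactor d.+1 1).
  by rewrite -!val_eqE /= !inordK.
by rewrite -val_eqE /= inordK.
Qed.

End PartialTrace.

(** * R-traces *)

Section Pairs.
Variables (A : pzSemiRingType) (N : nat).

Definition mat2 (f : 'I_N -> 'I_N -> 'I_N -> 'I_N -> A) : 'M[A]_#|midx N 2| :=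
  tmatrix (fun a b : midx N 2 => f (a ord0) (a ord_max) (b ord0) (b ord_max)).

Lemma entry2_mat2 f i j k l : entry2 (mat2 f) i j k l = f i j k l.
Proof. by rewrite /entry2 tentryE !ffunE. Qed.

Lemma pair_idxE (a : midx N 2) : a = pair_idx (a ord0) (a ord_max).
Proof.
apply/ffunP => t; rewrite ffunE; case: eqP => [-> //|/eqP h]; congr (a _).
by apply: val_inj; case: t h => -[|[|]].
Qed.

Lemma entry2P (X Y : 'M[A]_#|midx N 2|) :
  (forall i j k l, entry2 X i j k l = entry2 Y i j k l) -> X = Y.
Proof.
by move=> h; apply: tentryP => a b; rewrite (pair_idxE a) (pair_idxE b); exact: h.
Qed.

Lemma setl_pair i j x : setl (pair_idx i j : midx N 2) x = pair_idx i x.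
Proof.
apply/ffunP => t; rewrite !ffunE; case: eqP => [->|/eqP h] //.
by have -> : t = ord0 by apply: val_inj; case: t h => -[|[|]].
Qed.

End Pairs.

Lemma map_at_factors (A B : pzSemiRingType) (f : {rmorphism A -> B}) N d k
    (X : 'M[A]_#|midx N 2|) :
  map_mx f (at_factors d.+1 k X) = at_factors d.+1 k (map_mx f X).
Proof. by rewrite !at_factorsE map_at_pos. Qed.

Lemma entry2_map (A B : pzSemiRingType) (f : A -> B) N (X : 'M[A]_#|midx N 2|)
    (i j k l : 'I_N) : entry2 (map_mx f X) i j k l = f (entry2 X i j k l).
Proof. by rewrite /entry2 /tentry mxE. Qed.

Section ConjTrace.
Variables (K : fieldType) (N : nat) (C : 'M[K]_N).

(* The coefficients of Tr_(R(2)) U_12 X_1 V_12 as a linear function of X. *)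
Definition loop (U V : 'M[K]_#|midx N 2|) (p k z x : 'I_N) : K :=
  \sum_i \sum_j \sum_y C i j * (entry2 U p j x y * entry2 V z y k i).

Variable B : algType K.
Local Notation lift := (map_mx (in_alg B)).

(** U and V are numerical, hence their entries are central and can be collected in front. This
    reduces traces of conjugated operators to the scalar identities for [loop]. *)
Lemma ptr_conj d U V (X : 'M[B]_#|midx N d.+1|) a b :
  tentry (ptr C (lift (at_factors d.+2 d.+1 U) *m emb X
                 *m lift (at_factors d.+2 d.+1 V))) a b
  = \sum_x \sum_z loop U V (a ord_max) (b ord_max) z x
      *: tentry X (setl a x) (setl b z).
Proof.
rewrite tentryE !map_at_factors.
have e i j : tentry (at_factors d.+2 d.+1 (lift U) *m emb X
    *m at_factors d.+2 d.+1 (lift V)) (ext a j) (ext b i) =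
    \sum_x \sum_z \sum_y (entry2 U (a ord_max) j x y * entry2 V z y (b ord_max) i)
      *: tentry X (setl a x) (setl b z).
  rewrite -mulmxA lastMl; apply: eq_bigr => x _.
  rewrite [RHS]exchange_big; apply: eq_bigr => y _.
  rewrite lastMr mulr_sumr; apply: eq_bigr => z _.
  rewrite (bigD1 y) //= big1 => [|w hw].
    rewrite emb_entry eqxx addr0 !entry2_map /= -scalerAl mul1r -scalerAr mulr1.
    by rewrite scalerA.
  by rewrite emb_entry eq_sym (negbTE hw) mul0r.
under eq_bigr => i _ do under eq_bigr => j _ do rewrite e scaler_sumr.
under eq_bigr => i _ do rewrite exchange_big.
rewrite exchange_big; apply: eq_bigr => x _.
under eq_bigr => i _ do under eq_bigr => j _ do rewrite scaler_sumr.
under eq_bigr => i _ do rewrite exchange_big.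
rewrite exchange_big; apply: eq_bigr => z _.
rewrite scaler_suml; apply: eq_bigr => i _; rewrite scaler_suml; apply: eq_bigr => j _.
rewrite scaler_sumr scaler_suml; apply: eq_bigr => y _.
by rewrite scalerA.
Qed.

End ConjTrace.

Section SkewInvertible.
Variables (K : fieldType) (N : nat) (R Psi : 'M[K]_#|midx N 2|) (q : K).
Hypothesis hR : hecke_symmetry R q.
Hypothesis hPsi : skew_inverse R Psi.
Hypothesis hq0 : q != 0.
Local Notation C := (C_matrix Psi).
Local Notation rho := (entry2 R).
Local Notation psi := (entry2 Psi).

(** After a reshuffling of indices the skew inverse is an ordinary matrix inverse, and a one-sided
    inverse of a square matrix over a field is two-sided. *)
Lemma psi_rho l j j' l' :
  \sum_r \sum_p psi l p j r * rho r j' p l' = (j == j')%:R * (l == l')%:R.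
Proof.
pose M := mat2 (fun i k j l => rho i j k l).
pose M' := mat2 (fun j l r p => psi l p j r).
have e : M *m M' = 1%:M.
  apply: entry2P => i k r p; rewrite entry2M entry2_scalar.
  under eq_bigr => x _ do under eq_bigr => y _ do rewrite !entry2_mat2.
  by rewrite hPsi -natrM mulnb (eq_sym p).
have := congr1 (fun X => entry2 X j l j' l') (mulmx1C e).
rewrite entry2M entry2_scalar -natrM mulnb => <-.
by apply: eq_bigr => r _; apply: eq_bigr => p _; rewrite !entry2_mat2.
Qed.

Lemma rho_inv (F : 'I_N -> 'I_N -> K) z x : F z x = \sum_r \sum_p psi z p x r *
  \sum_x' \sum_z' F z' x' * rho r x' p z'.
Proof.
transitivity (\sum_x' \sum_z' F z' x' * ((x == x')%:R * (z == z')%:R)).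
  rewrite (bigD1 x) //= [X in _ + X]big1 ?addr0 => [|x' hx]; last first.
    by rewrite big1 // => z' _; rewrite eq_sym (negbTE hx) mul0r mulr0.
  rewrite (bigD1 z) //= big1 ?addr0 ?eqxx ?mulr1 // => z' hz.
  by rewrite [z == _]eq_sym (negbTE hz) !mulr0.
under eq_bigr => x' _ do under eq_bigr => z' _ do rewrite -psi_rho mulr_sumr.
under eq_bigr => x' _ do rewrite exchange_big.
rewrite exchange_big; apply: eq_bigr => r _.
under eq_bigr => x' _ do under eq_bigr => z' _ do rewrite mulr_sumr.
under eq_bigr => x' _ do rewrite exchange_big.
rewrite exchange_big; apply: eq_bigr => p _.
rewrite mulr_sumr; apply: eq_bigr => x' _; rewrite mulr_sumr.
by apply: eq_bigr => z' _; rewrite mulrCA.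
Qed.

(* The partial matrices of [R] span all matrices. *)
Lemma rho_span (F G : 'I_N -> 'I_N -> K) :
  (forall r p, \sum_x \sum_z F z x * rho r x p z = \sum_x \sum_z G z x * rho r x p z) ->
  forall z x, F z x = G z x.
Proof.
by move=> h z x; rewrite rho_inv (rho_inv G); apply: eq_bigr => r _;
  apply: eq_bigr => p _; rewrite h.
Qed.

(** The inverse of R according to the Hecke relation R^2 = 1 + (q - q^-1) R. Being explicit, it
    passes through tensor embeddings and scalar extension. *)
Definition Rinv : 'M[K]_#|midx N 2| := R - (q - q^-1)%:M.

Lemma RinvK : R *m Rinv = 1%:M /\ Rinv *m R = 1%:M.
Proof.
have [_ hq] := hR.
have sC c (x : 'M[K]_#|midx N 2|) : c%:M * x = x * c%:M by rewrite -!mulmxE scalar_mxC.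
have := quad_sqr hq0 (s := @scalar_mx K _) sC hq; rewrite -!mulmxE => e.
by split; rewrite /Rinv ?mulmxBl ?mulmxBr e -?scalar_mxC /= addrK.
Qed.

(** The coordinate form of Tr_(R(2)) R_12 = I. *)
Lemma C_unit i k : \sum_j \sum_l rho i j k l * C l j = (i == k)%:R.
Proof.
under eq_bigr => j _ do under eq_bigr => l _ do rewrite mxE mulr_sumr.
under eq_bigr => j _ do rewrite exchange_big.
rewrite exchange_big; under eq_bigr => p _ do rewrite hPsi.
rewrite (bigD1 i) //= big1 => [|p hp]; first by rewrite eqxx mul1r addr0.
by rewrite [i == _]eq_sym (negbTE hp) mul0r.
Qed.

Lemma setl_id d (a : midx N d.+1) : setl a (a ord_max) = a.
Proof. by apply/ffunP => t; rewrite ffunE; case: eqP => [->|]. Qed.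

Section PtrR.
Variable B : algType K.
Local Notation lift := (map_mx (in_alg B)).

Lemma ptr_R d : ptr C (lift (at_factors d.+2 d.+1 R)) = 1%:M.
Proof.
apply: tentryP => a b; rewrite tentryE tentry_scalar.
transitivity (\sum_i \sum_j \sum_x (C i j * rho (a ord_max) j x i)
    *: ((1 : B) *+ (setl a x == b))).
  apply: eq_bigr => i _; apply: eq_bigr => j _.
  rewrite map_at_factors -[at_factors _ _ _]mulmx1 lastMl scaler_sumr.
  apply: eq_bigr => x _; rewrite (bigD1 i) //= big1 => [|y hy].
    rewrite tentry_scalar eq_ext eqxx andbT entry2_map addr0 -scalerA.
    by rewrite mulr_algl.
  by rewrite tentry_scalar eq_ext (negbTE hy) andbF mulr0n mulr0.
under eq_bigr => i _ do rewrite exchange_big.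
rewrite exchange_big /=.
under eq_bigr => x _.
  under eq_bigr => i _ do rewrite -scaler_suml.
  rewrite -scaler_suml exchange_big /=.
  under eq_bigr => j _ do under eq_bigr => i _ do rewrite mulrC.
  rewrite C_unit; over.
rewrite (bigD1 (a ord_max)) //= big1 => [|x hx].
  by rewrite eqxx scale1r addr0 setl_id.
by rewrite eq_sym (negbTE hx) scale0r.
Qed.

End PtrR.

Lemma in_algK n (X : 'M[K]_n) : map_mx (in_alg K^o) X = X.
Proof. by apply/matrixP => i j; rewrite mxE; exact: mulr1. Qed.

Lemma emb_R : emb R = at_factors 3 1 R.
Proof.
rewrite at_factorsE; apply: eq_at_pos => t; apply: val_inj.
by rewrite /= pos2E.
Qed.

(* Tr_(R(3)) R_23 R_12 R_23^-1 = R_12^-1 (Tr_(R(3)) R_23) R_12 = 1, and [R_12] can be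
   replaced by an arbitrary matrix in factor 2 by [rho_span]. *)
Lemma loop_spec U V :
  at_factors 3 2 U *m emb R *m at_factors 3 2 V
    = emb Rinv *m at_factors 3 2 R *m emb R \/
  at_factors 3 2 U *m emb R *m at_factors 3 2 V
    = emb R *m at_factors 3 2 R *m emb Rinv ->
  forall p k z x, loop C U V p k z x = (p == k)%:R * C z x.
Proof.
move=> h p k; apply: rho_span => r s.
have /(congr1 (fun X => tentry X (pair_idx r p) (pair_idx s k))) :
    ptr C (at_factors 3 2 U *m emb R *m at_factors 3 2 V : 'M[K^o]_#|midx N 3|) = 1%:M.
  have [RK KR] := RinvK.
  by case: h => ->; rewrite (@ptr_embr _ _ C K^o) (@ptr_embl _ _ C K^o)
    -[at_factors 3 2 R]in_algK (ptr_R K^o) mulmx1.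
rewrite -[at_factors 3 2 U]in_algK -[at_factors 3 2 V]in_algK ptr_conj.
rewrite [RHS](entry2_scalar (1 : K)) !ffunE /= => e.
transitivity (((r == s) && (p == k))%:R : K).
  rewrite -[RHS]e; apply: eq_bigr => x _; apply: eq_bigr => z _.
  by rewrite !setl_pair.
under eq_bigr => x _ do under eq_bigr => z _ do rewrite -mulrA.
under eq_bigr => x _ do rewrite -mulr_sumr.
rewrite -mulr_sumr.
under eq_bigr => x _ do under eq_bigr => z _ do rewrite mulrC.
by rewrite C_unit -natrM mulnb andbC.
Qed.

Lemma at_factorsK d k : (0 < k)%N -> (k < d.+1)%N ->
  at_factors d.+1 k R *m at_factors d.+1 k Rinv = 1%:M /\
  at_factors d.+1 k Rinv *m at_factors d.+1 k R = 1%:M.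
Proof.
move=> k0 kd; have [e1 e2] := RinvK; rewrite !at_factorsE.
by rewrite -!at_posM ?e1 ?e2 ?at_pos_scalar //; exact: pos2_inj.
Qed.

Lemma emb_inv d (X Y : 'M[K]_#|midx N d.+1|) : X *m Y = 1%:M -> emb X *m emb Y = 1%:M.
Proof. by move=> e; rewrite -embM e emb_scalar. Qed.

(** In operator form: Tr_(R(2)) of R_12 X_1 R_12^(-1) and of R_12^(-1) X_1 R_12 are both Tr_R(X) I.
    The braid relation supplies the two alternatives of [loop_spec]. *)
Lemma loop_C : (forall p k z x, loop C R Rinv p k z x = (p == k)%:R * C z x) /\
  (forall p k z x, loop C Rinv R p k z x = (p == k)%:R * C z x).
Proof.
have [hb _] := hR; have [RK KR] := RinvK.
have [e1 e2] := (emb_inv RK, emb_inv KR).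
have [f1 f2] := @at_factorsK 2 2 isT isT.
rewrite /= -emb_R in hb.
split; apply: loop_spec; [left|right].
  rewrite -[LHS]mul1mx -e2 -!mulmxA; congr (_ *m _).
  by rewrite !mulmxA hb -!mulmxA f1 mulmx1.
rewrite -[RHS]mul1mx -f2 -!mulmxA; congr (_ *m _).
by rewrite !mulmxA -hb -!mulmxA e1 mulmx1.
Qed.

(** By [rho_inv] the left-hand side is recovered from its contractions with R, and these are the
    first formula of [loop_C]. The second formula gives the companion [C_Rinv_psi] in the same
    way. *)
Lemma Rinv_C_psi c b k j :
  \sum_s entry2 Rinv c b k s * C s j = \sum_p C c p * psi b p j k.
Proof.
rewrite (rho_inv (fun b j => \sum_s entry2 Rinv c b k s * C s j)).
have [h _] := loop_C.
have e r p : \sum_x \sum_z (\sum_s entry2 Rinv c z k s * C s x) * rho r x p z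
    = (r == k)%:R * C c p.
  rewrite -h /loop [RHS]exchange_big; apply: eq_bigr => x _.
  rewrite [RHS]exchange_big; apply: eq_bigr => y _; rewrite mulr_suml.
  by apply: eq_bigr => s _; ring.
rewrite (bigD1 k) //= [X in _ + X]big1 => [|r /negbTE hr]; last first.
  by rewrite big1 // => p _; rewrite e hr mul0r mulr0.
by rewrite addr0; apply: eq_bigr => p _; rewrite e eqxx mul1r mulrC.
Qed.

Lemma C_Rinv_psi p b x s :
  \sum_j entry2 Rinv p j x b * C s j = \sum_r psi s p b r * C r x.
Proof.
rewrite (rho_inv (fun s b => \sum_j entry2 Rinv p j x b * C s j)).
have [_ h] := loop_C.
have e r k : \sum_b \sum_s (\sum_j entry2 Rinv p j x b * C s j) * rho r b k s
    = (p == k)%:R * C r x.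
  rewrite -h /loop exchange_big; apply: eq_bigr => i _.
  rewrite [RHS]exchange_big; apply: eq_bigr => y _; rewrite mulr_suml.
  by apply: eq_bigr => j _; ring.
apply: eq_bigr => r _; rewrite (bigD1 p) //= [X in _ + X]big1 => [|k hk].
  by rewrite addr0 e eqxx mul1r.
by rewrite e [p == k]eq_sym (negbTE hk) mul0r mulr0.
Qed.

Definition C1C2 : 'M[K]_#|midx N 2| := mat2 (fun i j k l => C i k * C j l).

(** The two preceding formulas turn both orders of the product of R^-1 with C_1 C_2 into the same
    contraction of Psi with two copies of C; R differs from R^-1 by a scalar. *)
Lemma R_C1C2 : R *m C1C2 = C1C2 *m R.
Proof.
have e : Rinv *m C1C2 = C1C2 *m Rinv.
  apply: entry2P => c b a j; rewrite !entry2M.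
  transitivity (\sum_k \sum_p C c p * psi b p j k * C k a).
    apply: eq_bigr => k _; rewrite -mulr_suml -Rinv_C_psi mulr_suml.
    by apply: eq_bigr => s _; rewrite entry2_mat2; ring.
  rewrite exchange_big; apply: eq_bigr => p _.
  rewrite [RHS](_ : _ = C c p * \sum_j' entry2 Rinv p j' a j * C b j').
    by rewrite C_Rinv_psi mulr_sumr; apply: eq_bigr => k _; rewrite mulrA.
  by rewrite mulr_sumr; apply: eq_bigr => s _; rewrite entry2_mat2; ring.
have -> : R = Rinv + (q - q^-1)%:M by rewrite /Rinv subrK.
by rewrite mulmxDl mulmxDr e scalar_mxC.
Qed.

End SkewInvertible.

(** * Cyclicity of the R-trace and moving operators to the last factors *)

Section TraceCyclicity.
Variables (K : fieldType) (N : nat) (R Psi : 'M[K]_#|midx N 2|) (q : K).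
Hypothesis hR : hecke_symmetry R q.
Hypothesis hPsi : skew_inverse R Psi.
Hypothesis hq0 : q != 0.
Local Notation C := (C_matrix Psi).
Variable B : algType K.
Local Notation lift := (map_mx (in_alg B)).

Definition R_at d j : 'M[B]_#|midx N d.+1| := lift (at_factors d.+1 j R).
Definition Rinv_at d j : 'M[B]_#|midx N d.+1| := lift (at_factors d.+1 j (Rinv R q)).

Lemma R_atK d k : (0 < k)%N -> (k < d.+1)%N -> R_at d k * Rinv_at d k = 1.
Proof.
by move=> k0 kd; have [e _] := at_factorsK hR hq0 k0 kd; rewrite -mulmxE -map_mxM e map_mx1.
Qed.

Lemma Rinv_atK d k : (0 < k)%N -> (k < d.+1)%N -> Rinv_at d k * R_at d k = 1.
Proof.
by move=> k0 kd; have [_ e] := at_factorsK hR hq0 k0 kd; rewrite -mulmxE -map_mxM e map_mx1.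
Qed.

Lemma emb_R_at d k : (0 < k)%N -> (k < d.+1)%N -> emb (R_at d k) = R_at d.+1 k.
Proof. by move=> k0 kd; rewrite /emb -map_at_pos -[at_pos _ _]/(emb _) emb_factors. Qed.

Lemma emb_Rinv_at d k : (0 < k)%N -> (k < d.+1)%N -> emb (Rinv_at d k) = Rinv_at d.+1 k.
Proof. by move=> k0 kd; rewrite /emb -map_at_pos -[at_pos _ _]/(emb _) emb_factors. Qed.

(** Only the last two factors are affected: there [loop_C] contracts the last letter of X with C and
    leaves a Kronecker delta in the surviving factor. *)
Lemma ptr_conj_emb d (X : 'M[B]_#|midx N d.+2|) :
  ptr C (R_at d.+2 d.+2 * emb X * Rinv_at d.+2 d.+2) = emb (ptr C X).
Proof.
have [h _] := loop_C hR hPsi hq0.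
have exte (a : midx N d.+2) : exists a' p, a = ext a' p.
  exists (restr (@widen d) a), (a ord_max); apply/ffunP => t.
  by have [[u ->]|->] := widen_case t; rewrite ?ext_max ?ext_widen ?ffunE.
apply: tentryP => a b; rewrite -!mulmxE ptr_conj.
have [a' [p ->]] := exte a; have [b' [k ->]] := exte b.
rewrite !ext_max emb_entry tentryE exchange_big -sumrMnl; apply: eq_bigr => i _.
rewrite -sumrMnl; apply: eq_bigr => j _.
rewrite h !setl_ext; case: eqP => _; last by rewrite mul0r scale0r.
by rewrite mul1r.
Qed.

Lemma ptr_conj_base (X : 'M[B]_#|midx N 1|) :
  ptr C (R_at 1 1 * emb X * Rinv_at 1 1) = (rtrace C X)%:M.
Proof.
have [h _] := loop_C hR hPsi hq0.
apply: tentryP => a b; rewrite -!mulmxE ptr_conj tentry_scalar.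
have sum1 (V : nmodType) (F : midx N 1 -> V) : \sum_c F c = \sum_i F [ffun=> i].
  rewrite (reindex (fun i : 'I_N => [ffun=> i] : midx N 1)) //=.
  exists (fun c : midx N 1 => c ord0) => [i _|c _]; first by rewrite ffunE.
  by apply/ffunP => t; rewrite ffunE (ord1 t).
have setl1 (c : midx N 1) x : setl c x = [ffun=> x].
  by apply/ffunP => t; rewrite !ffunE (ord1 t) -(ord1 ord_max) eqxx.
rewrite /rtrace sum1 -sumrMnl exchange_big; apply: eq_bigr => i _.
rewrite sum1 -sumrMnl; apply: eq_bigr => j _.
rewrite h !setl1 big_ord1 !ffunE.
have -> : (a == b) = (a ord_max == b ord_max).
  by apply/eqP/eqP => [->|e] //; apply/ffunP => t; rewrite (ord1 t) -(ord1 ord_max).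
by case: eqP => _; rewrite ?mul1r // mul0r scale0r.
Qed.

(** The weight of the double trace is C_1 C_2, which commutes with R, and the entries of R are
    central. *)
Lemma ptr2_cyclic d (Y : 'M[B]_#|midx N d.+3|) :
  ptr C (ptr C (R_at d.+2 d.+2 * Y)) = ptr C (ptr C (Y * R_at d.+2 d.+2)).
Proof.
pose ext2 (a : midx N d.+1) (u : midx N 2) := ext (ext a (u ord0)) (u ord_max).
have ptr2E (X : 'M[B]_#|midx N d.+3|) a b : tentry (ptr C (ptr C X)) a b
    = \sum_v \sum_u tentry (C1C2 Psi) v u *: tentry X (ext2 a u) (ext2 b v).
  rewrite tentryE sum_midx2; apply: eq_bigr => i _.
  under [RHS]eq_bigr => i' _ do rewrite sum_midx2.
  rewrite [RHS]exchange_big; apply: eq_bigr => j _.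
  rewrite tentryE scaler_sumr; apply: eq_bigr => i' _.
  rewrite scaler_sumr; apply: eq_bigr => j' _.
  rewrite scalerA (_ : tentry (C1C2 Psi) _ _ = C i j * C i' j'); last exact: entry2_mat2.
  by rewrite /ext2 !ffunE.
have lE (X : 'M[B]_#|midx N d.+3|) a u c : tentry (R_at d.+2 d.+2 * X) (ext2 a u) c
    = \sum_w tentry R u w *: tentry X (ext2 a w) c.
  rewrite /R_at map_at_factors -mulmxE lastMl sum_midx2 ext_max.
  apply: eq_bigr => x _; apply: eq_bigr => y _.
  rewrite setl_ext entry2_map mulr_algl /entry2 -pair_idxE.
  by rewrite /ext2 !ffunE.
have rE (X : 'M[B]_#|midx N d.+3|) b u c : tentry (X * R_at d.+2 d.+2) c (ext2 b u)
    = \sum_w tentry R w u *: tentry X c (ext2 b w).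
  rewrite /R_at map_at_factors -mulmxE lastMr sum_midx2 ext_max.
  apply: eq_bigr => x _; apply: eq_bigr => y _.
  rewrite setl_ext entry2_map mulr_algr /entry2 -pair_idxE.
  by rewrite /ext2 !ffunE.
apply: tentryP => a b; rewrite !ptr2E.
transitivity (\sum_v \sum_w tentry (C1C2 Psi *m R) v w *: tentry Y (ext2 a w) (ext2 b v)).
  apply: eq_bigr => v _.
  under eq_bigr => u _ do rewrite lE scaler_sumr.
  rewrite exchange_big; apply: eq_bigr => w _.
  by rewrite tentryM scaler_suml; apply: eq_bigr => u _; rewrite scalerA.
rewrite -(R_C1C2 hR hPsi hq0) exchange_big [RHS]exchange_big; apply: eq_bigr => w _.
under [RHS]eq_bigr => v _ do rewrite rE scaler_sumr.
rewrite [RHS]exchange_big; apply: eq_bigr => v _.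
by rewrite tentryM scaler_suml; apply: eq_bigr => u _; rewrite scalerA mulrC.
Qed.

(** A property of G and not a general law: the entries of Y do not commute, C need not commute with
    G, and factor 1 is not traced. *)
Definition trace_cyclic d (G : 'M[B]_#|midx N d.+1|) := forall Y : 'M[B]_#|midx N d.+1|,
  rtrace_tail C (n := d.+1) (G * Y) = rtrace_tail C (n := d.+1) (Y * G).

(** The factors beyond j + 1 are traced out first; then R_j acts in the last two factors, and j >= 2
    ensures that both of them are traced. *)
Lemma trace_cyclic_R_at d j : (1 < j)%N -> (j < d.+1)%N -> trace_cyclic (R_at d j).
Proof.
elim: d j => [|d ih] j j1 jd Y; first by case: j j1 jd => [|[|]].
have [e|jn] := eqVneq j d.+1; last first.
  have jd' : (j < d.+1)%N by lia.
  rewrite -emb_R_at ?(ltnW j1) // !rtrace_tail_ptr -!mulmxE ptr_embl ptr_embr.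
  exact: ih.
case: d => [|d] in ih jd Y e *; first by rewrite e in j1.
by rewrite e !rtrace_tail_ptr ptr2_cyclic.
Qed.

Lemma trace_cyclic_mul d G H : @trace_cyclic d G -> trace_cyclic H -> trace_cyclic (G * H).
Proof. by move=> hG hH Y; rewrite -mulrA hG -mulrA hH mulrA. Qed.

Lemma trace_cyclic_inv d (G H : 'M[B]_#|midx N d.+1|) : G * H = 1 -> H * G = 1 ->
  trace_cyclic G -> trace_cyclic H.
Proof.
move=> GH HG hG Y; rewrite -[Y in LHS]mulr1 -HG !mulrA -hG.
by rewrite !mulrA GH mul1r.
Qed.

Lemma rtrace_tail1 (Y : 'M[B]_#|midx N 1|) i j :
  rtrace_tail C (n := 1) Y i j = tentry Y [ffun=> i] [ffun=> j].
Proof.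
have e k (a : midx N 1) : (a (tfactor 1 1) == k) = (a == [ffun=> k]).
  apply/eqP/eqP => [<-|->]; last by rewrite ffunE.
  by apply/ffunP => t; rewrite ffunE (ord1 t) (ord1 (tfactor 1 1)).
rewrite mxE (eq_bigl _ _ (e j)) big_pred1_eq (eq_bigl _ _ (e i)) big_pred1_eq.
by rewrite big1 ?scale1r // => t; rewrite (ord1 t) (ord1 (tfactor 1 1)) eqxx.
Qed.

Lemma rtrace_tail_first d X (Y : 'M[B]_#|midx N d.+1|) :
  rtrace_tail C (n := d.+1) (at_first d.+1 X * Y)
  = X *m rtrace_tail C (n := d.+1) Y.
Proof.
elim: d Y => [|d ih] Y; last first.
  by rewrite -emb_first !rtrace_tail_ptr -mulmxE ptr_embl; exact: ih.
apply/matrixP => i j; rewrite rtrace_tail1 mxE -mulmxE at_firstE at_posMl;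
  last exact: pos1_inj.
rewrite (reindex (fun i : 'I_N => [ffun=> i] : midx N 1)) /=; last first.
  exists (fun c : midx N 1 => c ord0) => [x _|c _]; first by rewrite ffunE.
  by apply/ffunP => t; rewrite ffunE (ord1 t).
apply: eq_bigr => x _; rewrite rtrace_tail1 tentryE !ffunE; congr (_ * tentry _ _ _).
apply/ffunP => t; rewrite !ffunE; case: pickP => [u _|/(_ ord0)]; first by rewrite ffunE.
by rewrite /pos1 (ord1 t) (ord1 (tfactor 1 1)) eqxx.
Qed.

Lemma rtrace_tail_scalar (c : B) : rtrace_tail C (n := 1) (c%:M : 'M[B]_#|midx N 1|) = c%:M.
Proof.
apply/matrixP => i j; rewrite rtrace_tail1 tentry_scalar mxE; congr (_ *+ nat_of_bool _).
by apply/eqP/eqP => [/ffunP/(_ ord0)|->]; rewrite ?ffunE.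
Qed.

Definition scal d : {rmorphism K -> 'M[B]_#|midx N d.+1|} :=
  @scalar_mx B _ \o in_alg B.

Lemma scal_comm d c x : scal d c * x = x * scal d c.
Proof.
rewrite /= -!mulmxE mul_scalar_mx; apply/matrixP => i j; rewrite !mxE.
rewrite (bigD1 j) //= big1 => [|k hk]; first by rewrite !mxE eqxx addr0 mulr_algl mulr_algr.
by rewrite !mxE (negbTE hk) mulr0.
Qed.

Lemma R_at_hecke d : hecke_rel q (scal d) d.+1 (R_at d).
Proof.
have [h1 h2 h3] := at_factors_hecke hR d.
split=> [i i0 id|i j i0 ij jd|i i0 id].
- by have := congr1 (map_mx (in_alg B)) (h1 i i0 id); rewrite !rmorphM.
- by have := congr1 (map_mx (in_alg B)) (h2 i j i0 ij jd); rewrite !rmorphM.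
- have := congr1 (map_mx (in_alg B)) (h3 i i0 id).
  by rewrite rmorphM rmorphB rmorphD rmorph0 /= !map_scalar_mx.
Qed.

(* Conjugation by R_1 ... R_d moves operators on the first d of d+1 factors to the
   last d factors. *)
Definition shift_braid d := \prod_(1 <= j < d.+1) R_at d j.

(** Recursive in the last factor, so that it unfolds in parallel with [shift_braidS] when this
    factor is traced out. *)
Fixpoint shift_braid_inv d : 'M[B]_#|midx N d.+1| :=
  if d is e.+1 then Rinv_at e.+1 e.+1 * emb (shift_braid_inv e) else 1.

Lemma emb_one d : emb (1 : 'M[B]_#|midx N d.+1|) = 1.
Proof. exact: emb_scalar. Qed.

Lemma emb_mul d (X Y : 'M[B]_#|midx N d.+1|) : emb (X * Y) = emb X * emb Y.
Proof. exact: embM. Qed.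

Lemma emb_prod d (F : nat -> 'M[B]_#|midx N d.+1|) m n :
  emb (\prod_(m <= j < n) F j) = \prod_(m <= j < n) emb (F j).
Proof.
by apply: (big_morph (@emb B N d)); [exact: emb_mul|exact: emb_one].
Qed.

Lemma emb_prod_R_at d : \prod_(1 <= j < d.+1) R_at d.+1 j = emb (shift_braid d).
Proof. by rewrite emb_prod; apply: eq_big_nat => j /andP[j0 jd]; rewrite emb_R_at. Qed.

Lemma shift_braidS d : shift_braid d.+1 = emb (shift_braid d) * R_at d.+1 d.+1.
Proof. by rewrite {1}/shift_braid big_nat_recr //= emb_prod_R_at. Qed.

Lemma shift_braidK d : shift_braid d * shift_braid_inv d
  = 1 /\ shift_braid_inv d * shift_braid d = 1.
Proof.
elim: d => [|d [e1 e2]]; first by rewrite /shift_braid big_geq // mulr1.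
rewrite shift_braidS /=; split.
  by rewrite -mulrA (mulrA (R_at _ _)) R_atK // mul1r -emb_mul e1 emb_one.
by rewrite -mulrA (mulrA (emb _)) -emb_mul e2 emb_one mul1r Rinv_atK.
Qed.

Lemma ptr_mull d X Y : ptr C (emb X * Y) = X * @ptr K N C B d Y.
Proof. exact: ptr_embl. Qed.

Lemma ptr_mulr d X Y : ptr C (Y * emb X) = @ptr K N C B d Y * X.
Proof. exact: ptr_embr. Qed.

(** Tracing out the last factor replaces X by its partial trace and shortens the braid by one
    letter; with one factor left, the full R-trace appears as a scalar. *)
Lemma rtrace_tail_conj d (X : 'M[B]_#|midx N d.+1|) :
  rtrace_tail C (n := d.+2) (shift_braid d.+1 * emb X * shift_braid_inv d.+1)
    = (rtrace C (n := d.+1) X)%:M.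
Proof.
elim: d X => [|d ih] X.
  rewrite rtrace_tail_ptr shift_braidS /shift_braid big_geq
    // emb_one mul1r /= emb_one mulr1.
  by rewrite ptr_conj_base rtrace_tail_scalar.
rewrite rtrace_tail_ptr shift_braidS [shift_braid_inv _]/= -[X in ptr C X]mulrA -[X
  in ptr C X]mulrA.
rewrite ptr_mull !mulrA ptr_mulr ptr_conj_emb mulrA ih.
by rewrite -rtrace_ptr.
Qed.

Lemma shift_braid_prod d k : (k <= d.+1)%N ->
  shift_braid d.+1 * \prod_(1 <= j < k) R_at d.+1 j
    = \prod_(1 <= j < k) R_at d.+1 j.+1 * shift_braid d.+1.
Proof.
elim: k => [|[|k] ih] kd; try by rewrite !big_geq // mul1r mulr1.
rewrite !(big_nat_recr k.+1) //= mulrA ih ?(ltnW kd) // -!mulrA; congr (_ * _).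
by apply: (shift_r (R_at_hecke d.+1)).
Qed.

(** Write the braid as R_1 Z' with Z' = R_2 ... R_(d+1). The inverse of Z' is cyclic and moves to
    the front, where conjugating R_1 by it gives R_(d+1) conjugated by an operator of the first d+1
    factors. The trace over the last factor then sees R_(d+1) alone and equals I. *)
Lemma rtrace_tail_shift d (X : 'M[B]_#|midx N d.+1|) :
  rtrace_tail C (n := d.+2) (shift_braid d.+1 * emb X * shift_braid_inv d.+1 * R_at d.+1 1)
  = rtrace_tail C (n := d.+1) X.
Proof.
pose Z' := \prod_(1 <= j < d.+1) R_at d.+1 j.+1.
pose Z'V := shift_braid_inv d.+1 * R_at d.+1 1.
have zE : shift_braid d.+1 = R_at d.+1 1 * Z' by rewrite /shift_braid big_nat_recl.
have [zK Kz] := shift_braidK d.+1.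
have KZ' : Z'V * Z' = 1 by rewrite /Z'V -mulrA -zE.
have Z'K : Z' * Z'V = 1.
  have -> : Z' = Rinv_at d.+1 1 * shift_braid d.+1 by rewrite zE mulrA Rinv_atK // mul1r.
  by rewrite /Z'V -mulrA (mulrA (shift_braid _)) zK mul1r Rinv_atK.
have ZVE : shift_braid_inv d.+1 * R_at d.+1 1 = Z'V by [].
clearbody Z'V; have cZ : trace_cyclic Z'V.
  apply: (trace_cyclic_inv Z'K KZ'); rewrite /Z' big_nat.
  apply: (big_ind (@trace_cyclic d.+1)) => [Y|G H|j /andP[j0 jd]];
    first by rewrite mulr1 mul1r.
    exact: trace_cyclic_mul.
  by apply: trace_cyclic_R_at => //; rewrite ltnS.
(* The long braid times the short one is Z' times the long braid, and the long braid is the short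
   one times its last letter. *)
have e : Z'V * (R_at d.+1 1 * Z')
  = emb (shift_braid d) * R_at d.+1 d.+1 * emb (shift_braid_inv d).
  have [zdK _] := shift_braidK d.
  rewrite -[LHS]mulr1 -emb_one -zdK emb_mul -zE -!mulrA (mulrA (shift_braid _)).
  have := shift_braid_prod (leqnn d.+1); rewrite emb_prod_R_at => ->.
  by rewrite -/Z' -!mulrA (mulrA Z'V) KZ' mul1r shift_braidS -mulrA.
rewrite -mulrA ZVE -cZ zE !mulrA -(mulrA Z'V) e -!mulrA -emb_mul.
rewrite rtrace_tail_ptr ptr_mull ptr_mulr (_ : ptr C _ = 1); last exact: ptr_R.
by have [zdK _] := shift_braidK d; rewrite mul1r mulrA zdK mul1r.
Qed.

End TraceCyclicity.

(** * The defining relations with shifted arguments *)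

Lemma fpscoef_sum (A : nzRingType) (I : finType) (F : I -> fps A) k :
  (\sum_i F i) k = \sum_i F i k.
Proof. by apply: (big_morph (fun f : fps A => f k)). Qed.

Lemma fpscoef_muln (A : nzRingType) (f : fps A) n k : (f *+ n) k = f k *+ n.
Proof. by elim: n => [|n ih] //; rewrite !mulrS -ih. Qed.

(** Summing over a fixed square of exponents with an indicator avoids dependent ranges when sums are
    exchanged. *)
Lemma fps_mulE (A : nzRingType) (f g : fps A) n M : (n < M)%N ->
  (f * g) n = \sum_(p : 'I_M * 'I_M) (f p.1 * g p.2) *+ (p.1 + p.2 == n)%N.
Proof.
move=> nM; rewrite -(pair_bigA _ (fun i j : 'I_M => (f i * g j) *+ (i + j == n)%N)) /=.
rewrite (big_ord_widen M (fun i => f i * g (n - i)%N)) // big_mkcond.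
apply: eq_bigr => i _; case: ltnP => hi; last first.
  by rewrite big1 // => j _; case: eqP => // e; move: hi; rewrite -e ltnNge leq_addr.
have hj : (n - i < M)%N by rewrite (leq_ltn_trans (leq_subr _ _)).
rewrite (bigD1 (Ordinal hj)) //= big1 => [|j /eqP nj].
  by rewrite subnKC // eqxx addr0.
by case: eqP => // e; case: nj; apply: val_inj; rewrite /= -e addKn.
Qed.

Section SeriesEvaluation.
Variables (K : fieldType) (A : algType K).

(* The substitution u^-1 := c u^-1, v^-1 := d u^-1. *)
Definition fps_ev (c d : K) (F : fps (fps A)) : fps A :=
  Fps (fun n => \sum_(i < n.+1) (c ^+ i * d ^+ (n - i)) *: F i (n - i)%N).

Lemma fps_evE c d F n M : (n < M)%N -> fps_ev c d F n =
  \sum_(p : 'I_M * 'I_M) ((c ^+ p.1 * d ^+ p.2) *: F p.1 p.2) *+ (p.1 + p.2 == n)%N.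
Proof.
move=> nM.
rewrite -(pair_bigA _ (fun i j : 'I_M => ((c ^+ i * d ^+ j) *:
  F i j) *+ (i + j == n)%N)) /=.
rewrite (big_ord_widen M (fun i => (c ^+ i * d ^+ (n - i)) *: F i (n - i)%N)) // big_mkcond.
apply: eq_bigr => i _; case: ltnP => hi; last first.
  by rewrite big1 // => j _; case: eqP => // e; move: hi; rewrite -e ltnNge leq_addr.
have hj : (n - i < M)%N by rewrite (leq_ltn_trans (leq_subr _ _)).
rewrite (bigD1 (Ordinal hj)) //= big1 => [|j /eqP nj].
  by rewrite subnKC // eqxx addr0.
by case: eqP => // e; case: nj; apply: val_inj; rewrite /= -e addKn.
Qed.

Lemma sum_pair_collapse (V : nmodType) (T : nat -> nat -> V) M n (x y : nat) : (n < M)%N ->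
  \sum_(p : 'I_M * 'I_M) T p.1 p.2 *+ (x == p.1)%N *+ (y == p.2)%N *+ (p.1 + p.2 == n)%N
  = T x y *+ (x + y == n)%N.
Proof.
move=> nM; case: eqP => [e|ne]; last first.
  rewrite big1 // => p _; case: eqP => [ex|]; last by rewrite !mul0rn.
  case: eqP => [ey|]; last by rewrite mul0rn.
  by case: eqP => // e; case: ne; rewrite ex ey.
have xM : (x < M)%N by rewrite (leq_ltn_trans _ nM) // -e leq_addr.
have yM : (y < M)%N by rewrite (leq_ltn_trans _ nM) // -e leq_addl.
rewrite (bigD1 (Ordinal xM, Ordinal yM)) //= !eqxx e eqxx big1 ?addr0 // => p np.
case: eqP => [ex|]; last by rewrite !mul0rn.
case: eqP => [ey|]; last by rewrite mul0rn.
case/eqP: np.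
by case: p ex ey => p1 p2 /= ex ey; congr (_, _); exact: val_inj.
Qed.

Variables c d : K.

Fact fps_ev_zmod : zmod_morphism (fps_ev c d).
Proof.
move=> F G; apply/fpsP => n /=; rewrite -sumrB.
by apply: eq_bigr => i _; rewrite scalerBr.
Qed.

(** Both sides become one sum over quadruples of exponents, via [sum_pair_collapse]. For F * G they
    are grouped by variable, for the product of the values by series; the two middle indices are
    then interchanged. *)
Fact fps_ev_monoid : monoid_morphism (fps_ev c d).
Proof.
split=> [|F G]; apply/fpsP => n.
  rewrite /= big_ord_recl big1 => [|i _]; last by rewrite /= scaler0.
  by rewrite /= subn0 addr0 expr0 mul1r; case: n => [|n]; rewrite ?expr0 ?scale1r ?scaler0.
pose w (i j : nat) := c ^+ i * d ^+ j.
rewrite (fps_evE c d (F * G) (ltnSn n)) (fps_mulE _ _ (ltnSn n)).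
transitivity (\sum_(s : 'I_n.+1 * 'I_n.+1) \sum_(t : 'I_n.+1 * 'I_n.+1)
  (w (s.1 + s.2)%N (t.1 + t.2)%N *: (F s.1 t.1 * G s.2 t.2)) *+
     (s.1 + s.2 + (t.1 + t.2) == n)%N).
  have ce (s t : 'I_n.+1 * 'I_n.+1) :
    (w (s.1 + s.2)%N (t.1 + t.2)%N *: (F s.1 t.1 * G s.2 t.2)) *+
       (s.1 + s.2 + (t.1 + t.2) == n)%N
    = \sum_(p : 'I_n.+1 * 'I_n.+1) (w p.1 p.2 *: (F s.1 t.1 * G s.2 t.2)) *+
        (s.1 + s.2 == p.1)%N *+ (t.1 + t.2 == p.2)%N *+ (p.1 + p.2 == n)%N.
    by rewrite (sum_pair_collapse (fun i j => w i j *: (F s.1 t.1 * G s.2 t.2))).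
  under [RHS]eq_bigr => s _ do under eq_bigr => t _ do rewrite ce.
  under [RHS]eq_bigr => s _ do rewrite exchange_big.
  rewrite [RHS]exchange_big; apply: eq_bigr => p _.
  rewrite (fps_mulE _ _ (ltn_ord p.1)) fpscoef_sum scaler_sumr -sumrMnl.
  apply: eq_bigr => s _.
  rewrite fpscoef_muln (fps_mulE _ _ (ltn_ord p.2)) -sumrMnl scaler_sumr -sumrMnl.
  by apply: eq_bigr => t _; rewrite (mulrnAC (F s.1 t.1 * G s.2 t.2)) !scalerMnr.
have ce (s t : 'I_n.+1 * 'I_n.+1) :
    ((w s.1 s.2 *: F s.1 s.2) * (w t.1 t.2 *: G t.1 t.2)) *+
       (s.1 + s.2 + (t.1 + t.2) == n)%N
    = \sum_(p : 'I_n.+1 * 'I_n.+1) ((w s.1 s.2 *: F s.1 s.2) * (w t.1 t.2 *: G t.1 t.2)) *+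
        (s.1 + s.2 == p.1)%N *+ (t.1 + t.2 == p.2)%N *+ (p.1 + p.2 == n)%N.
  by rewrite (sum_pair_collapse
    (fun i j => (w s.1 s.2 *: F s.1 s.2) * (w t.1 t.2 *: G t.1 t.2))).
rewrite [RHS](_ : _ = \sum_(s : 'I_n.+1 * 'I_n.+1) \sum_(t : 'I_n.+1 * 'I_n.+1)
   ((w s.1 s.2 *: F s.1 s.2) * (w t.1 t.2 *: G t.1 t.2)) *+
       (s.1 + s.2 + (t.1 + t.2) == n)%N); last first.
  under [RHS]eq_bigr => s _ do under eq_bigr => t _ do rewrite ce.
  under [RHS]eq_bigr => s _ do rewrite exchange_big.
  rewrite [RHS]exchange_big; apply: eq_bigr => p _.
  rewrite (fps_evE _ _ _ (ltn_ord p.1)) (fps_evE _ _ _ (ltn_ord p.2)) mulr_suml -sumrMnl.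
  apply: eq_bigr => s _; rewrite mulr_sumr -sumrMnl.
  by apply: eq_bigr => t _; rewrite mulrnAr mulrnAl.
rewrite -(pair_bigA _ (fun a a' : 'I_n.+1 => \sum_(t : 'I_n.+1 * 'I_n.+1)
  (w (a + a')%N (t.1 + t.2)%N *: (F a t.1 * G a' t.2)) *+ (a + a' + (t.1 + t.2) == n)%N)).
rewrite -(pair_bigA _ (fun a b : 'I_n.+1 => \sum_(t : 'I_n.+1 * 'I_n.+1)
  ((w a b *: F a b) * (w t.1 t.2 *: G t.1 t.2)) *+ (a + b + (t.1 + t.2) == n)%N)).
apply: eq_bigr => a _.
under eq_bigr => a' _ do rewrite -(pair_bigA _ (fun b b' : 'I_n.+1 =>
  (w (a + a')%N (b + b')%N *: (F a b * G a' b')) *+ (a + a' + (b + b') == n)%N)).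
rewrite exchange_big; apply: eq_bigr => b _.
rewrite -(pair_bigA _ (fun a' b' : 'I_n.+1 =>
  ((w a b *: F a b) * (w a' b' *: G a' b')) *+ (a + b + (a' + b') == n)%N)) /=.
apply: eq_bigr => a' _; apply: eq_bigr => b' _.
rewrite addnACA -scalerAl -scalerAr scalerA; congr ((_ *: _) *+ _).
by rewrite /w !exprD; ring.
Qed.

HB.instance Definition _ :=
  GRing.isZmodMorphism.Build (fps (fps A)) (fps A) (fps_ev c d) fps_ev_zmod.
HB.instance Definition _ :=
  GRing.isMonoidMorphism.Build (fps (fps A)) (fps A) (fps_ev c d) fps_ev_monoid.

End SeriesEvaluation.

Lemma map_at_first (A B : pzSemiRingType) (f : {additive A -> B}) N d (X : 'M[A]_N) :
  map_mx f (at_first d.+1 X) = at_first d.+1 (map_mx f X).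
Proof.
apply: tentryP => a b.
by rewrite [RHS]tentryE /tentry !mxE !enum_rankK raddfMn.
Qed.

Lemma at_factors2 (A : pzSemiRingType) N (X : 'M[A]_#|midx N 2|) : at_factors 2 1 X = X.
Proof.
have e (a : midx N 2) : restr (pos2 1 1) a = a.
  by rewrite -pair_restr (tfactor_widen 0) tfactor_max [RHS]pair_idxE;
    congr (pair_idx (a _) _); apply: val_inj.
rewrite at_factorsE; apply: tentryP => a b; rewrite tentryE !e.
suff -> : agree (pos2 1 1) a b by [].
apply/agreeP => t /codomP []; exists t; apply: val_inj; exact/esym/pos2E.
Qed.

Lemma map_mx_exchange (S T : pzRingType) (f : {rmorphism S -> T}) n
    (D U X V : 'M[S]_n) :
  map_mx f (D *m U *m X *m V - V *m X *m U *m D) =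
  map_mx f D *m map_mx f U *m map_mx f X *m map_mx f V -
  map_mx f V *m map_mx f X *m map_mx f U *m map_mx f D.
Proof. by rewrite map_mxB !map_mxM. Qed.

Section TwoParameters.
Variables (K : fieldType) (N : nat) (R : 'M[K]_#|midx N 2|) (q : K).
Variables (A : algType K) (L : 'M[fps A]_N).
Hypothesis hL : yangian_rel R q L = 0.
Local Notation lift := (map_mx (in_alg (fps A))).

Lemma fps_varMl (f : fps A) n : (fps_var A * f) n = if n is k.+1 then f k else 0.
Proof.
case: n => [|n] /=; first by rewrite big_ord1 mul0r.
rewrite big_ord_recl big_ord_recl big1 => [|i _]; last by rewrite /= mul0r.
by rewrite mul0r mul1r add0r addr0 /bump /= subSS subn0.
Qed.

Lemma fps_varMr (f : fps A) n : (f * fps_var A) n = if n is k.+1 then f k else 0.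
Proof.
case: n => [|n] /=; first by rewrite big_ord1 mulr0.
rewrite big_ord_recr big_ord_recr big1 => [|i _] /=; last first.
  have -> : (n.+1 - i == 1)%N = false by case: i => i /= hi; lia.
  by rewrite mulr0.
by rewrite subnn subSn // subnn mulr0 mulr1 add0r addr0.
Qed.

Lemma fps_varC (f : fps A) : fps_var A * f = f * fps_var A.
Proof. by apply/fpsP => n; rewrite fps_varMl fps_varMr. Qed.

(** Removes the factor u^-1 that clearing the denominator leaves after the substitution. *)
Lemma fps_varI (f g : fps A) : fps_var A * f = fps_var A * g -> f = g.
Proof. by move/fpsP => h; apply/fpsP => n; have := h n.+1; rewrite !fps_varMl. Qed.

Lemma fps_ev_alg c d (x : K) : fps_ev c d (x%:A : fps (fps A)) = x%:A.
Proof.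
apply/fpsP => n; rewrite /= big_ord_recl big1 => [|i _]; last by rewrite /= !scaler0.
rewrite /= subn0 addr0 expr0 mul1r; case: n => [|n]; rewrite ?expr0 ?scale1r //=.
by rewrite !scaler0.
Qed.

Lemma fps_ev_varu c d : fps_ev c d (fps_var (fps A)) = c *: fps_var A.
Proof.
apply/fpsP => -[|n]; first by rewrite /= big_ord1 /= !scaler0.
rewrite /= big_ord_recl big_ord_recl big1 => [|i _]; last by rewrite /= scaler0.
rewrite /= scaler0 add0r addr0 /bump /= subSS subn0 expr1.
by case: n => [|n]; rewrite ?expr0 ?mulr1 ?scaler0.
Qed.

Lemma fps_ev_const c d (f : fps A) : fps_ev c d (fps_const f) = fps_dil d^-1 f.
Proof.
apply/fpsP => n; rewrite /= big_ord_recl big1 => [|i _]; last by rewrite /= scaler0.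
by rewrite /= subn0 addr0 expr0 mul1r exprVn invrK.
Qed.

Lemma fps_ev_map_const c d (f : fps A) :
  fps_ev c d (fps_map (@fps_const A) f) = fps_dil c^-1 f.
Proof.
apply/fpsP => n; rewrite /= big_ord_recr big1 => [|i _] /=; last first.
  have : (0 < n - i)%N by rewrite subn_gt0.
  by case: (n - i)%N => // k _; rewrite scaler0.
by rewrite subnn expr0 mulr1 add0r exprVn invrK.
Qed.

(** The substitution sends v^-1 - u^-1 to (d - c) u^-1, so the cleared R-matrix becomes u^-1 times a
    constant matrix. Replacing u^-1 by x u^-1 means replacing u by x^-1 u, hence the inverses in
    [l]. *)
Lemma yangian_rel_ev (c d : K) :
  let D := lift ((d - c) *: R - (d * (q - q^-1))%:M) in
  let l x := at_first 2 (Ldil L x^-1) in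
  D *m l c *m lift R *m l d = l d *m lift R *m l c *m D.
Proof.
move=> D l.
have eD : map_mx (fps_ev c d) ((fps_const (fps_var A) - fps_var (fps A)) *:
    map_mx (in_alg (fps (fps A))) R - ((q - q^-1) *: fps_const (fps_var A))%:M)
    = fps_var A *: D.
  have evB F G : fps_ev c d (F - G) = fps_ev c d F - fps_ev c d G by exact: rmorphB.
  have evM F G : fps_ev c d (F * G) = fps_ev c d F * fps_ev c d G by exact: rmorphM.
  have evn F n : fps_ev c d (F *+ n) = fps_ev c d F *+ n by exact: rmorphMn.
  apply/matrixP => i j; rewrite !mxE evB evM evn evB.
  rewrite -[(q - q^-1) *: _]mulr_algl evM !fps_ev_alg fps_ev_varu fps_ev_const.
  have -> : fps_dil d^-1 (fps_var A) = d *: fps_var A.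
    apply/fpsP => n /=; rewrite exprVn invrK.
    by case: n => [|[|n]]; rewrite ?expr1 //= !scaler0.
  by rewrite -scalerBl -scalerAl -!scalerAr mulr1 !mulr_algl !scalerA scalerMnl -scalerBl.
have eu : map_mx (fps_ev c d) (map_mx (fps_map (@fps_const A)) L) = Ldil L c^-1.
  by apply/matrixP => i j; rewrite !mxE fps_ev_map_const.
have ev : map_mx (fps_ev c d) (map_mx (@fps_const (fps A)) L) = Ldil L d^-1.
  by apply/matrixP => i j; rewrite !mxE fps_ev_const.
have eR : map_mx (fps_ev c d) (map_mx (in_alg (fps (fps A))) R) = lift R.
  by apply/matrixP => i j; rewrite !mxE fps_ev_alg.
have : map_mx (fps_ev c d) (yangian_rel R q L) = 0 by rewrite hL map_mx0.
rewrite /yangian_rel map_mx_exchange map_at_first map_at_first eu ev eR eD.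
rewrite -!scalemxAl.
have cE X : X *m (fps_var A *: D) = fps_var A *: (X *m D).
  apply/matrixP => i j; rewrite !mxE mulr_sumr; apply: eq_bigr => k _.
  by rewrite mxE mulrA -fps_varC mulrA.
rewrite cE -scalerBr => /matrixP h; apply/matrixP => i j; apply: fps_varI.
by apply/eqP; rewrite -subr_eq0 -mulrBr; have := h i j; rewrite !mxE => ->.
Qed.

End TwoParameters.

Lemma intertwine_absorb (M : pzRingType) (z zV a p x : M) :
  z * a = p * z -> a * x = x -> p * (z * x * zV) = z * x * zV.
Proof. by move=> e ax; rewrite !mulrA -e -(mulrA z) ax. Qed.

(** * Copies of L(u) and the Newton recursion *)

Lemma intertwine_sandwich (M : pzRingType) (z c x y x' y' : M) :
  z * c = c * z -> z * x = x' * z -> z * y = y' * z ->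
  z * (c * (x * y * x)) = c * (x' * y' * x') * z.
Proof.
move=> ec ex ey; rewrite mulrA ec -!mulrA; congr (c * _).
by rewrite mulrA ex -mulrA (mulrA z) ey -mulrA ex.
Qed.

Section Copies.
Variables (K : fieldType) (N : nat) (R Psi : 'M[K]_#|midx N 2|) (q : K).
Hypotheses (hq0 : q != 0) (hq : forall n : int, n != 0 -> q ^ n != 1).
Hypothesis hR : hecke_symmetry R q.
Hypothesis hPsi : skew_inverse R Psi.
Variables (B : algType K) (l : nat -> 'M[B]_N).
Local Notation lift := (map_mx (in_alg B)).
Local Notation R_at := (R_at R B).
Local Notation Rinv_at := (Rinv_at R q B).
Local Notation scal := (scal N B).
Local Notation shift_braid := (shift_braid R B).
Local Notation shift_braid_inv := (shift_braid_inv R q B).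
Local Notation C := (C_matrix Psi).

(* L_(bar j)(q^(-2a) u), when [l a] is L(q^(-2a) u) *)
Fixpoint copy d j a : 'M[B]_#|midx N d.+1| :=
  if j is i.+1 then
    if i is 0%N then at_first d.+1 (l a) else R_at d i * copy d i a * Rinv_at d i
  else 1.

Arguments copy : simpl never.

Lemma copyS d j a : (0 < j)%N -> copy d j.+1 a = R_at d j * copy d j a * Rinv_at d j.
Proof. by case: j. Qed.

Lemma emb_copy d j a : (0 < j)%N -> (j <= d.+1)%N -> emb (copy d j a) = copy d.+1 j a.
Proof.
elim: j => [//|[|j] ih] _ jd; first exact: emb_first.
by rewrite (@copyS d j.+1) // (@copyS d.+1 j.+1) // !emb_mul ih ?(ltnW jd)
  // emb_R_at // emb_Rinv_at.
Qed.

Lemma R_at_copy1 d i a : (1 < i)%N -> (i < d.+1)%N ->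
  R_at d i * copy d 1 a = copy d 1 a * R_at d i.
Proof.
move=> i1 id; rewrite /copy at_firstE /R_at map_at_factors at_factorsE -!mulmxE.
apply: at_pos_comm.
- by apply: pos2_inj => //; exact: ltnW.
- exact: pos1_inj.
- move=> t t'; apply/eqP => /(congr1 val); rewrite /= pos2E ?(ltnW i1) // /pos1 inordK //.
  by lia.
- move=> a0 b0 a1 b1; rewrite (_ : tentry _ a0 b0 = (tentry R a0 b0)%:A).
    by rewrite mulr_algl mulr_algr.
  by rewrite /tentry mxE.
Qed.

Hypothesis rll2 : forall a m, (0 < m)%N ->
  baxter q (scal 1) (R_at 1) 1 m * (copy 1 1 a * copy 1 2 (a + m)%N)
  = copy 1 1 (a + m)%N * copy 1 2 a * baxter q (scal 1) (R_at 1) 1 m.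

Let lS d j a (j0 : (0 < j)%N) (_ : (j < d.+1)%N) := @copyS d j a j0.

Lemma emb_scal d c : emb (scal d c) = scal d.+1 c.
Proof. exact: emb_scalar. Qed.

Lemma emb_baxter d i m : (0 < i)%N -> (i < d.+1)%N ->
  emb (baxter q (scal d) (R_at d) i m) = baxter q (scal d.+1) (R_at d.+1) i m.
Proof. by move=> i0 id; rewrite /baxter -emb_R_at // -emb_scal /emb at_posD at_posN. Qed.

Lemma rll d i a m : (0 < i)%N -> (i < d.+1)%N -> (0 < m)%N ->
  baxter q (scal d) (R_at d) i m * (copy d i a * copy d i.+1 (a + m)%N)
  = copy d i (a + m)%N * copy d i.+1 a * baxter q (scal d) (R_at d) i m.
Proof.
move=> i0 id m0.
have d0 : (0 < d)%N by lia.
apply: (rll_shift (@scal_comm K N B d) (R_at_hecke hR B d) (@R_atK K N R q hR hq0 B d)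
  (@Rinv_atK K N R q hR hq0 B d) (@lS d) (@R_at_copy1 d)) => // {i i0 id}.
elim: d d0 => [//|[|d] ih] _; first exact: rll2.
by rewrite -emb_baxter // -!(emb_copy (d := d.+1)) // -!emb_mul ih.
Qed.

Lemma copy_comm d i j a : (0 < i)%N -> (i < d.+1)%N -> (0 < j)%N -> (j <= d.+1)%N ->
  j != i -> j != i.+1 -> R_at d i * copy d j a = copy d j a * R_at d i.
Proof.
exact: (r_l_comm (R_at_hecke hR B d) (@R_atK K N R q hR hq0 B d)
  (@Rinv_atK K N R q hR hq0 B d) (@lS d) (@R_at_copy1 d)).
Qed.

Lemma shift_braid_copy d j a : (0 < j)%N -> (j < d.+1)%N ->
  shift_braid d * copy d j a = copy d j.+1 a * shift_braid d.
Proof.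
exact: (shift_l (R_at_hecke hR B d) (@R_atK K N R q hR hq0 B d)
  (@Rinv_atK K N R q hR hq0 B d) (@lS d) (@R_at_copy1 d)).
Qed.

Lemma shift_braid_R_at d j : (0 < j)%N -> (j.+1 < d.+1)%N ->
  shift_braid d * R_at d j = R_at d j.+1 * shift_braid d.
Proof. exact: (shift_r (R_at_hecke hR B d)). Qed.

Local Notation alt := (fun d => asym q (scal d) (R_at d)).

Definition copies d (f : nat -> nat) k : 'M[B]_#|midx N d.+1| :=
  \prod_(1 <= j < k.+1) copy d j (f j).

(* Its R-trace is e_(d+1)(u); its R-trace over factors 2, ..., d+1 is the
   skew-symmetric power of L. *)
Definition skew_prod d := copies d (fun j => d.+1 - j)%N d.+1 * alt d d.+1.

Lemma skew_prod_reverse d :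
  alt d d.+1 * copies d predn d.+1 = skew_prod d.
Proof.
exact: (asym_reverse hq0 hq (@scal_comm K N B d) (R_at_hecke hR B d) (@copy_comm d)
  (@rll d) 0 (leqnn _)).
Qed.

Lemma alt_idem d : alt d d.+1 * alt d d.+1 = alt d d.+1.
Proof.
have [h _] := asym_skew hq0 hq (@scal_comm K N B d) (R_at_hecke hR B d) (leqnn _).
exact: (asym_absorbl hq0 hq (@scal_comm K N B d)).
Qed.

(** By the reversal the skew-symmetrizer also stands on the left. In shifted form this absorbs the
    outer factor that cyclicity brings to the front in the Newton recursion. *)
Lemma alt_skew_prod d : alt d d.+1 * skew_prod d = skew_prod d.
Proof. by rewrite -skew_prod_reverse mulrA alt_idem. Qed.

Lemma emb_alt d k : (k <= d.+1)%N -> emb (alt d k) = alt d.+1 k.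
Proof.
elim: k => [|[|k] ih] kd; try exact: emb_one.
rewrite (@asymS _ q _ (scal d) (R_at d) k.+1)
  // (@asymS _ q _ (scal d.+1) (R_at d.+1) k.+1) //.
by rewrite !emb_mul emb_scal ih ?(ltnW kd) // emb_baxter.
Qed.

Lemma shift_braid_copies d f : shift_braid d.+1 * emb (copies d f d.+1)
  = (\prod_(1 <= j < d.+2) copy d.+1 j.+1 (f j)) * shift_braid d.+1.
Proof.
rewrite /copies emb_prod.
suff h k : (k <= d.+1)%N -> shift_braid d.+1 * \prod_(1 <= j < k.+1) emb (copy d j (f j))
    = \prod_(1 <= j < k.+1) copy d.+1 j.+1 (f j) * shift_braid d.+1 by exact: h.
elim: k => [|k ih] kd; first by rewrite !big_geq // mul1r mulr1.
rewrite !(big_nat_recr k.+1) //= mulrA ih ?(ltnW kd) // emb_copy //.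
have := @shift_braid_copy d.+1 k.+1 (f k.+1) isT kd.
move: (copy d.+1 k.+1 _) (copy d.+1 k.+2 _) => c c' e.
by rewrite -[LHS]mulrA -[RHS]mulrA e.
Qed.

Lemma shift_braid_alt d k : (k <= d.+1)%N ->
  shift_braid d.+1 * alt d.+1 k = asym q (scal d.+1) (fun i =>
    R_at d.+1 i.+1) k * shift_braid d.+1.
Proof.
elim: k => [|[|k] ih] kd; try by rewrite mul1r mulr1.
have {}ih := ih (ltnW kd).
have eb : shift_braid d.+1 * baxter q (scal d.+1) (R_at d.+1) k.+1 k.+1
    = baxter q (scal d.+1) (fun i => R_at d.+1 i.+1) k.+1 k.+1 * shift_braid d.+1.
  by rewrite mulrBl mulrBr scal_comm shift_braid_R_at.
rewrite (@asymS _ q _ (scal d.+1) (R_at d.+1) k.+1) //.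
rewrite (@asymS _ q _ (scal d.+1) (fun i => R_at d.+1 i.+1) k.+1) //.
exact: (intertwine_sandwich (esym (scal_comm _ _)) ih eb).
Qed.

Local Notation tail d := (rtrace_tail C (A := B) (n := d.+1)).

Lemma tail_scale d c X : tail d (scal d c * X) = c%:A *: tail d X.
Proof.
apply/matrixP => i j; rewrite !mxE mulr_sumr; apply: eq_bigr => a _.
rewrite mulr_sumr; apply: eq_bigr => b _.
rewrite mulr_algl scalerA mulrC -scalerA; congr (_ *: _).
by rewrite /= -mulmxE mul_scalar_mx /tentry mxE mulr_algl.
Qed.

Lemma tailB d X Y : tail d (X - Y) = tail d X - tail d Y.
Proof.
apply/matrixP => i j; rewrite !mxE -sumrB; apply: eq_bigr => a _.
rewrite -sumrB; apply: eq_bigr => b _.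
by rewrite -scalerBr /tentry !mxE.
Qed.

(** Only R_2, R_3, ... occur, all of them cyclic, and the property is closed under products and
    differences. *)
Lemma trace_cyclic_shift_alt d k : (k <= d.+1)%N ->
  trace_cyclic Psi (asym q (scal d.+1) (fun i => R_at d.+1 i.+1) k).
Proof.
have cs c : trace_cyclic Psi (scal d.+1 c) by move=> Y; rewrite scal_comm.
have c1 : trace_cyclic Psi (1 : 'M[B]_#|midx N d.+2|) by move=> Y; rewrite mul1r mulr1.
elim: k => [|[|k] ih] kd; try exact: c1.
have {}ih := ih (ltnW kd).
rewrite (@asymS _ q _ (scal d.+1) (fun i => R_at d.+1 i.+1) k.+1) //.
apply: trace_cyclic_mul => //; apply: trace_cyclic_mul => //;
  apply: trace_cyclic_mul => // Y.
by rewrite /baxter mulrBl mulrBr !tailB cs (trace_cyclic_R_at hR hPsi hq0).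
Qed.

Lemma shift_prod_split d (X P : 'M[B]_#|midx N d.+1|) (T : 'M[B]_#|midx N d.+2|)
    (f : nat -> nat) :
  X = copies d f d.+1 * P -> shift_braid d.+1 * emb P = T * shift_braid d.+1 ->
  shift_braid d.+1 * emb X * shift_braid_inv d.+1
    = (\prod_(1 <= j < d.+2) copy d.+1 j.+1 (f j)) * T.
Proof.
move=> -> e; have [zK _] := shift_braidK hR hq0 B d.+1; have h := shift_braid_copies d f.
rewrite emb_mul; move: e zK h.
move: (shift_braid _) (shift_braid_inv _) (emb (copies _ _ _)) (emb P) (\prod_(_ <=
  _ < _) _) => z zV c p y e zK h.
by rewrite (mulrA z) h -(mulrA y) e -!mulrA zK mulr1.
Qed.

Lemma copies_recl d f : copies d.+1 f d.+2
  = copy d.+1 1 (f 1%N) * \prod_(1 <= j < d.+2) copy d.+1 j.+1 (f j.+1).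
Proof. by rewrite /copies big_nat_recl. Qed.

(* The mirrored recursion for the skew-symmetrizer yields both terms of the Newton
   recursion: [rtrace_tail_conj] evaluates its scalar part and [rtrace_tail_shift]
   its part with [R_1]. *)
Lemma tail_skew_prodS d : tail d.+1 (skew_prod d.+1)
  = l d.+1 *m ((qint q d.+1 / qint q d.+2)%:A *:
      ((bweight q d.+1)%:A *: (rtrace C (skew_prod d))%:M - tail d (skew_prod d))).
Proof.
pose P' := asym q (scal d.+1) (fun i => R_at d.+1 i.+1) d.+1.
pose F := shift_braid d.+1 * emb (skew_prod d) * shift_braid_inv d.+1.
have zP : shift_braid d.+1 * emb (alt d d.+1)
  = P' * shift_braid d.+1 by rewrite emb_alt // shift_braid_alt.
have FE : F = (\prod_(1 <= j < d.+2) copy d.+1 j.+1 (d.+1 - j)) * P'.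
  by apply: (shift_prod_split (X := skew_prod d) (f := fun j => (d.+1 - j)%N) _ zP).
have PF : P' * F = F.
  have eS : emb (alt d d.+1) * emb (skew_prod d) = emb (skew_prod d).
    by rewrite -emb_mul alt_skew_prod.
  exact: intertwine_absorb zP eS.
have cP : trace_cyclic Psi P' by exact: trace_cyclic_shift_alt.
rewrite {1}/skew_prod copies_recl (asym_mirror hq0 hq (@scal_comm K N B d.+1)
  (R_at_hecke hR B d.+1)) //.
have {}FE : F = (\prod_(1 <= j < d.+2) copy d.+1 j.+1 (d.+2 - j.+1)) * P'.
  by rewrite FE; congr (_ * _); apply: eq_bigr => j _; rewrite subSS.
rewrite -/P' subn1 -[copy d.+1 1 d.+1]/(at_first d.+2 (l d.+1)).
have -> x y c z : x * y * (scal d.+1 c * (P' * z * P'))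
    = x * (scal d.+1 c * (y * P' * z * P')) :> 'M[B]_#|midx N d.+2|.
  rewrite -(mulrA x); congr (x * _); rewrite mulrA -scal_comm -!mulrA.
  by congr (_ * _); rewrite !mulrA.
rewrite rtrace_tail_first -FE tail_scale -cP mulrA PF; congr (_ *m (_ *: _)).
rewrite /baxter mulrBr -scal_comm tailB tail_scale; congr (_ *: _ - _).
  exact: rtrace_tail_conj.
exact: rtrace_tail_shift.
Qed.

(** The operator under the trace in the matrix power L^[d+1](u). *)
Definition braid_prod d := copies d (fun j => d.+1 - j)%N d.+1 *
  \prod_(1 <= j < d.+1) R_at d (d.+1 - j)%N.

(** The longer braid word is the shifted shorter one followed by R_1, so [rtrace_tail_shift] strips
    it once the first copy has left the trace. *)
Lemma tail_braid_prodS d : tail d.+1 (braid_prod d.+1) = l d.+1 *m tail d (braid_prod d).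
Proof.
pose T := \prod_(1 <= j < d.+1) R_at d.+1 (d.+1 - j)%N.+1.
have zT : shift_braid d.+1 * emb (\prod_(1 <= j < d.+1) R_at d (d.+1 - j)%N)
  = T * shift_braid d.+1.
  rewrite emb_prod /T.
  suff h k : (k <= d.+1)%N -> shift_braid d.+1 * \prod_(1 <= j < k) emb (R_at d
    (d.+1 - j)%N)
      = \prod_(1 <= j < k) R_at d.+1 (d.+1 - j)%N.+1 * shift_braid d.+1 by exact: h.
  elim: k => [|[|k] ih] kd; try by rewrite !big_geq // mul1r mulr1.
  rewrite !(big_nat_recr k.+1) //= mulrA ih ?(ltnW kd) // emb_R_at; try lia.
  have := @shift_braid_R_at d.+1 (d.+1 - k.+1)%N; rewrite subn_gt0 => /(_ kd).
  have hd : ((d.+1 - k.+1).+1 < d.+2)%N by lia.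
  by move=> /(_ hd) e; rewrite -[LHS]mulrA e mulrA.
have FE := shift_prod_split (X := braid_prod d) (f := fun j => (d.+1 - j)%N) (erefl _) zT.
have eT : \prod_(1 <= j < d.+2) R_at d.+1 (d.+2 - j)%N = T * R_at d.+1 1.
  rewrite big_nat_recr //= subSnn; congr (_ * _).
  by apply: eq_big_nat => j /andP[j0 jd]; rewrite subSn // ltnW.
rewrite {1}/braid_prod copies_recl eT subn1 -[copy d.+1 1 d.+1]/(at_first d.+2 (l d.+1)).
rewrite -mulrA rtrace_tail_first; congr (_ *m _).
rewrite -[RHS](rtrace_tail_shift hR hPsi hq0) mulrA; congr (rtrace_tail _ (_ * _)).
by apply: etrans (esym FE); congr (_ * _); apply: eq_bigr => j _; rewrite subSS.
Qed.

Lemma tail_braid_prod0 : tail 0 (braid_prod 0) = l 0.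
Proof.
rewrite /braid_prod /copies big_nat1 big_geq // -[copy _ _ _]/(at_first 1 (l 0)).
by rewrite rtrace_tail_first rtrace_tail_scalar mulmx1.
Qed.

Lemma tail_skew_prod0 : tail 0 (skew_prod 0) = l 0.
Proof.
rewrite /skew_prod /copies big_nat1 -[copy _ _ _]/(at_first 1 (l 0)).
by rewrite rtrace_tail_first rtrace_tail_scalar mulmx1.
Qed.

End Copies.

(** The invertible central [k] is cancelled and the relation multiplied by r^-1 on the right: r v
    r^-1 and r u r^-1 are then second copies, and b passes r^-1 because it commutes with r. *)
Lemma rll_of_exchange (M : pzRingType) (kV k b u r v rV : M) :
  kV * k = 1 -> (forall x, k * x = x * k) -> r * rV = 1 -> rV * r = 1 -> b * r = r * b ->
  k * b * u * r * v = v * r * u * (k * b) ->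
  b * (u * (r * v * rV)) = v * (r * u * rV) * b.
Proof.
move=> kK kC rK Kr br e.
have {}e : b * u * r * v = v * r * u * b.
  have ek : k * (b * u * r * v) = k * (v * r * u * b).
    by rewrite !mulrA e (mulrA _ k) -kC !mulrA.
  by rewrite -[LHS]mul1r -[RHS]mul1r -kK -!(mulrA kV) ek.
have brV : b * rV = rV * b.
  by rewrite -[b in LHS]mul1r -Kr -!mulrA (mulrA r) -br -!mulrA rK mulr1.
by rewrite !mulrA e -!mulrA brV.
Qed.

(** * The Cayley-Hamilton identity *)

Section Dilation.
Variables (K : fieldType) (A : algType K) (c : K).

Fact fps_dil_zmod : zmod_morphism (@fps_dil K A c).
Proof. by move=> f g; apply/fpsP => n /=; rewrite scalerBr. Qed.

Fact fps_dil_monoid : monoid_morphism (@fps_dil K A c).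
Proof.
split=> [|f g]; apply/fpsP => n /=.
  by case: n => [|n]; rewrite ?scaler0 // expr0 invr1 scale1r.
rewrite scaler_sumr; apply: eq_bigr => i _.
rewrite -scalerAl -scalerAr scalerA -!exprVn -exprD subnKC //.
by rewrite -ltnS.
Qed.

HB.instance Definition _ :=
  GRing.isZmodMorphism.Build (fps A) (fps A) (@fps_dil K A c) fps_dil_zmod.
HB.instance Definition _ :=
  GRing.isMonoidMorphism.Build (fps A) (fps A) (@fps_dil K A c) fps_dil_monoid.

End Dilation.

Section CayleyHamilton.
Variables (K : fieldType) (N : nat) (R Psi : 'M[K]_#|midx N 2|) (q : K).
Hypotheses (hq0 : q != 0) (hq : forall n : int, n != 0 -> q ^ n != 1).
Hypothesis hR : hecke_symmetry R q.
Hypothesis hPsi : skew_inverse R Psi.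
Variables (A : algType K) (L : 'M[fps A]_N).
Hypothesis hL : yangian_rel R q L = 0.
Hypothesis hL0 : forall i j, L i j 0%N = (i == j)%:R.
Local Notation lift := (map_mx (in_alg (fps A))).
Local Notation C := (C_matrix Psi).

Definition Lshift a : 'M[fps A]_N := Ldil L (q ^- (2 * a)).
Local Notation copy := (copy R q Lshift).

Lemma Lbar_copy d j a : (0 < j)%N -> (j <= d.+1)%N ->
  Lbar R L d.+1 j (q ^- (2 * a)) = copy d j a.
Proof.
elim: j => [//|[//|j] ih] _ jd.
rewrite (@copyS _ _ R q (fps A) Lshift d j.+1 a) // -ih ?(ltnW jd) //.
(* The definition conjugates with [invmx]; uniqueness of inverses identifies it with the explicit
   inverse. *)
have [e1 e2] := at_factorsK hR hq0 (ltn0Sn j) jd; have [u1 _] := mulmx1_unit e1.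
suff <- : lift (invmx (at_factors d.+1 j.+1 R)) = Rinv_at R q (fps A) d j.+1 by [].
by congr (map_mx _ _); rewrite -[LHS]mulmx1 -e1 mulmxA mulVmx // mul1mx.
Qed.

(** For v = q^(-2m) u the coefficient u (q - q^-1)/(u - v) of R(u,v) is q^m/m_q. Here this is read
    off after clearing denominators, with u^-1 and v^-1 scaled by q^(2a) and q^(2(a+m)). *)
Lemma baxter_weight a m : (0 < m)%N ->
  (q ^+ (2 * a) - q ^+ (2 * (a + m))) * bweight q m
  = - (q ^+ (2 * (a + m)) * (q - q^-1)).
Proof.
move=> m0; have := qdiff_neq0 hq0 hq m0; rewrite /bweight /qint.
have := qdiff_neq0 hq0 hq (ltn0Sn 0); rewrite !expr1 => d1.
have x0 : q ^+ m != 0 by rewrite expf_neq0.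
rewrite !(mulnC 2%N) mulnDl (exprD q (a * 2) (m * 2)) (exprM q a) (exprM q m).
move: (q ^+ m) x0 => x x0 dx.
have x2 : x ^+ 2 - 1 != 0.
  by have := mulf_neq0 x0 dx; rewrite mulrBr divff // expr2.
have q2 : q ^+ 2 - 1 != 0.
  by have := mulf_neq0 hq0 d1; rewrite mulrBr divff // expr2.
by field; rewrite ?hq0 ?x0 -?expr2 /= ?q2 ?x2.
Qed.

Lemma rll_base a m : (0 < m)%N ->
  baxter q (scal N (fps A) 1) (R_at R (fps A) 1) 1 m * (copy 1 1 a * copy 1 2 (a + m)%N)
  = copy 1 1 (a + m)%N * copy 1 2 a * baxter q (scal N (fps A) 1) (R_at R (fps A) 1) 1 m.
Proof.
move=> m0; pose c := q ^+ (2 * a); pose d := q ^+ (2 * (a + m)).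
have := yangian_rel_ev hL c d.
set D := map_mx _ _; set b := baxter _ _ _ _ _.
have bE : b = lift ((bweight q m)%:M - R).
  by rewrite map_mxB map_scalar_mx /b /baxter /R_at at_factors2.
have DE : D = scal N (fps A) 1 (c - d) * b.
  rewrite bE (_ : scal N (fps A) 1 (c - d) = lift (c - d)%:M);
    last by rewrite map_scalar_mx.
  rewrite -mulmxE -map_mxM; congr (map_mx _ _).
  rewrite mulmxBr -scalar_mxM baxter_weight // mul_scalar_mx.
  by rewrite -[d - c]opprB scaleNr raddfN /= addrC.
(* If c = d, the weight identity would force q = q^-1. *)
have cd0 : c - d != 0.
  apply: contraTneq (qdiff_neq0 hq0 hq m0) => e; apply/negPn.
  have := baxter_weight a m0; rewrite -/c -/d e mul0r => /esym/eqP.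
  rewrite oppr_eq0 mulf_eq0 expf_eq0 (negbTE hq0) andbF /=.
  by have := qdiff_neq0 hq0 hq (ltn0Sn 0); rewrite !expr1 => /negbTE ->.
have sK : scal N (fps A) 1 (c - d)^-1 * scal N (fps A) 1 (c - d) = 1.
  by rewrite -rmorphM mulVf // rmorph1.
rewrite DE => e.
have rE : R_at R (fps A) 1 1 = lift R by rewrite /R_at at_factors2.
have rK := @R_atK K N R q hR hq0 (fps A) 1 1 isT isT.
have Kr := @Rinv_atK K N R q hR hq0 (fps A) 1 1 isT isT.
have bC : b * R_at R (fps A) 1 1 = R_at R (fps A) 1 1 * b.
  by rewrite /b mulrBl mulrBr scal_comm.
have e2 x : copy 1 2 x = R_at R (fps A) 1 1 * copy 1 1 x * Rinv_at R q (fps A) 1 1.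
  exact: copyS.
rewrite (e2 a) (e2 (a + m)%N).
apply: (rll_of_exchange sK (scal_comm _) rK Kr bC); rewrite rE; exact: e.
Qed.

Lemma lift_skew_symmetrizer d k :
  lift (skew_symmetrizer R q d.+1 k) = asym q (scal N (fps A) d) (R_at R (fps A) d) k.
Proof.
elim: k => [|[|k] ih]; try exact: map_mx1.
rewrite (@asymS _ q _ (scal N (fps A) d) (R_at R (fps A) d) k.+1) // -ih.
rewrite -[skew_symmetrizer _ _ _ _]/(_ *: (skew_symmetrizer R q d.+1 k.+1 *m
  ((bweight q k.+1)%:M - at_factors d.+1 k.+1 R) *m skew_symmetrizer R q d.+1 k.+1)).
rewrite map_mxZ !map_mxM map_mxB map_scalar_mx -!mulmxE.
by rewrite -[RHS]/(_%:M *m _) mul_scalar_mx.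
Qed.

Lemma elem_symE d :
  elem_sym R q C L d.+1 = rtrace C (skew_prod R q Lshift d).
Proof.
rewrite -(skew_prod_reverse hq0 hq hR rll_base) -lift_skew_symmetrizer.
rewrite /elem_sym mulmxE; congr (rtrace _ (_ * _)).
by apply: eq_big_nat => j /andP[j0 jd]; rewrite Lbar_copy.
Qed.

Lemma LpowE d : Lpow R q C L d.+1 = rtrace_tail C (braid_prod R q Lshift d).
Proof.
rewrite /Lpow /braid_prod -mulmxE; congr (rtrace_tail _ (_ *m _)).
  by apply: eq_big_nat => j /andP[j0 jd]; rewrite Lbar_copy.
exact: (rmorph_prod (map_mx (in_alg (fps A)))).
Qed.

Lemma LpowS d : Lpow R q C L d.+1 = Lshift d *m Lpow R q C L d.
Proof.
rewrite LpowE; case: d => [|d]; first by rewrite tail_braid_prod0 mulmx1.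
by rewrite (tail_braid_prodS hq0 hR hPsi) -LpowE.
Qed.

Lemma scale_alg_mulmx (c : K) (X Y : 'M[fps A]_N) : c%:A *: (X *m Y) = X *m (c%:A *: Y).
Proof.
apply/matrixP => i j; rewrite !mxE mulr_sumr; apply: eq_bigr => k _.
by rewrite !mxE !mulr_algl scalerAr.
Qed.

Lemma scale_algA (a b : K) (X : 'M[fps A]_N) : a%:A *: (b%:A *: X) = (a * b)%:A *: X.
Proof. by rewrite scalerA -scalerAl mul1r scalerA. Qed.

Lemma Lshift_dil a p (X : 'M[fps A]_N) :
  map_mx (fps_dil (q ^- (2 * p))) (Lshift a *m X)
  = Lshift (a + p) *m map_mx (fps_dil (q ^- (2 * p))) X.
Proof.
rewrite map_mxM; congr (_ *m _); apply/matrixP => i j; rewrite !mxE.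
apply/fpsP => n /=; rewrite scalerA -!exprVn !invrK -exprMn -exprD -mulnDr.
by rewrite addnC.
Qed.

Definition ch_sum k : 'M[fps A]_N := \sum_(p < k.+1)
  ((- q) ^+ p)%:A *: (map_mx (fps_dil (q ^- (2 * p))) (Lpow R q C L (k - p))
                      *m (elem_sym R q C L p)%:M).

Lemma ch_sum0 : ch_sum 0 = 1%:M.
Proof. by rewrite /ch_sum big_ord1 expr0 /= scale1r map_mx1 mul1mx scale1r. Qed.

(** The leading factor L(q^(-2(k-p)) u) of L^[k+1-p](u) becomes L(q^(-2k) u) under the dilation by
    q^(-2p), whatever p is, and so factors out of the sum. *)
Lemma ch_sumS k : ch_sum k.+1
  = Lshift k *m ch_sum k + ((- q) ^+ k.+1)%:A *: (elem_sym R q C L k.+1)%:M.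
Proof.
rewrite /ch_sum big_ord_recr /= subnn map_mx1 mul1mx; congr (_ + _).
rewrite mulmx_sumr; apply: eq_bigr => p _.
have pk : (p <= k)%N by rewrite -ltnS.
rewrite (subSn pk) LpowS Lshift_dil (subnK pk) -[_ *m _ *m _]mulmxA.
exact: scale_alg_mulmx.
Qed.

Lemma ch_sum_skew d : ch_sum d.+1 = ((-1) ^+ d.+1)%:A *:
  ((q ^+ d.+1)%:A *: (elem_sym R q C L d.+1)%:M
   - (qint q d.+1)%:A *: rtrace_tail C (skew_prod R q Lshift d)).
Proof.
elim: d => [|d ih].
  rewrite ch_sumS ch_sum0 mulmx1 tail_skew_prod0 (qint1 hq0 hq) !expr1.
  rewrite scale1r scale1r scalerBr scale_algA mulN1r addrC.
  by rewrite scaleN1r scaleN1r opprK.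
rewrite ch_sumS ih (tail_skew_prodS hq0 hq hR hPsi rll_base) -elem_symE.
have nz := qint_neq0 hq0 hq (ltn0Sn d.+1).
have nz' := qint_neq0 hq0 hq (ltn0Sn d).
move: (Lshift _) (elem_sym _ _ _ _ _)%:M (elem_sym _ _ _ _ _)%:M (rtrace_tail _ _).
move=> X e1 e2 W; rewrite [RHS]scalerBr [RHS]addrC; congr (_ + _); last first.
  by rewrite scale_algA -exprMn mulN1r.
rewrite !scale_alg_mulmx -mulmxN; congr (_ *m _).
rewrite !scalerBr !scale_algA.
(* The q-integer of the claim cancels the denominator of the Newton recursion, and the change of
   sign matches the term inherited from the shorter sum. *)
have -> : (-1) ^+ d.+2 * qint q d.+2 * (qint q d.+1 / qint q d.+2)
    = - ((-1) ^+ d.+1 * qint q d.+1).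
  rewrite exprS mulN1r !mulNr -(mulrA ((-1) ^+ d.+1)); congr (- (_ * _)).
  by rewrite mulrC divfK.
have -> : - ((-1) ^+ d.+1 * qint q d.+1) * bweight q d.+1 = - ((-1) ^+ d.+1 * q ^+ d.+1).
  by rewrite mulNr -mulrA /bweight (mulrC (qint _ _)) divfK.
by rewrite !scaleNr opprB opprK addrC.
Qed.

(** As L[0] = I, the n-th coefficient of the product is that of X plus terms in lower coefficients
    of X, which vanish by strong induction; no inverse series is constructed. *)
Lemma Lshift_cancel a (X : 'M[fps A]_N) : Lshift a *m X = 0 -> X = 0.
Proof.
move=> h; apply/matrixP => i j; rewrite mxE; apply/fpsP => n.
elim/ltn_ind: n i j => n ih i j.
have := congr1 (fun Y : 'M[fps A]_N => Y i j n) h.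
rewrite !mxE fpscoef_sum => e.
rewrite -[RHS]e (bigD1 i) //= big_ord_recl big1 => [|k _]; last first.
  rewrite !mxE lift0 ih ?mulr0 //.
  by rewrite ltn_subrL; case: (n) k => [[]|].
rewrite subn0 addr0 !mxE /= hL0 eqxx expr0 invr1 scale1r mul1r.
rewrite [X in _ + X]big1 ?addr0 // => k /negbTE hk.
rewrite big_ord_recl big1 => [|k' _]; last first.
  rewrite !mxE lift0 ih ?mulr0 //.
  by rewrite ltn_subrL; case: (n) k' => [[]|].
by rewrite !mxE /= hL0 eq_sym hk scaler0 mul0r addr0.
Qed.

Lemma cayley_hamilton m : (0 < m)%N ->
  skew_symmetrizer R q m.+1 m.+1 = 0 -> ch_sum m = 0.
Proof.
case: m => // d _ P0; apply: (@Lshift_cancel d.+1).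
have W0 : rtrace_tail C (skew_prod R q Lshift d.+1) = 0.
  rewrite /skew_prod -lift_skew_symmetrizer P0 map_mx0 mulr0.
  apply/matrixP => i j; rewrite !mxE big1 // => a _; rewrite big1 // => b _.
  by rewrite /tentry mxE scaler0.
(* The sum for m + 1 is computed twice: both results contain the same multiple of e_(m+1)(u), which
   cancels and leaves L(q^(-2m) u) times the sum for m. *)
have := ch_sum_skew d.+1; rewrite W0 scaler0 subr0 scale_algA ch_sumS.
by rewrite -exprMn mulN1r => /eqP; rewrite -subr_eq0 addrK => /eqP.
Qed.

End CayleyHamilton.

(** * The relations for the generating matrix of the braided Yangian *)

Lemma fpscoef_natr (A : nzRingType) n k : (n%:R : fps A) k = ((k == 0%N)%:R *+ n).
Proof. by rewrite fpscoef_muln. Qed.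

(** The relations are natural in the algebra. For the projection from the free algebra, every
    coefficient then becomes the class of a relator, hence zero. *)
Lemma map_yangian_rel (K : fieldType) (N : nat) (R : 'M[K]_#|midx N 2|) (q : K)
    (A B : algType K) (phi : {lrmorphism A -> B}) (L : 'M[fps A]_N) :
  map_mx (fps_map (fps_map phi)) (yangian_rel R q L)
  = yangian_rel R q (map_mx (fps_map phi) L).
Proof.
pose f : {rmorphism fps (fps A) -> fps (fps B)} := fps_map (fps_map phi).
have fA (c : K) : f c%:A = c%:A.
  apply/fpsP => m; apply/fpsP => n; rewrite /= linearZ /=.
  by rewrite !fpscoef_natr rmorphMn rmorph_nat.
have fu : f (fps_var (fps A)) = fps_var (fps B).
  by apply/fpsP => m; apply/fpsP => n /=; rewrite !fpscoef_natr rmorphMn rmorph_nat.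
have fv : f (fps_const (fps_var A)) = fps_const (fps_var B).
  by apply/fpsP => -[|m]; apply/fpsP => n /=; rewrite ?rmorph_nat ?rmorph0.
have eR : map_mx f (map_mx (in_alg (fps (fps A))) R) = map_mx (in_alg (fps (fps B))) R.
  by apply/matrixP => i j; rewrite !mxE; exact: fA.
have eu : map_mx f (map_mx (fps_map (@fps_const A)) L)
    = map_mx (fps_map (@fps_const B)) (map_mx (fps_map phi) L).
  apply/matrixP => i j; rewrite !mxE; apply/fpsP => m; apply/fpsP => -[|n] //=.
  exact: rmorph0.
have ev : map_mx f (map_mx (@fps_const (fps A)) L)
    = map_mx (@fps_const (fps B)) (map_mx (fps_map phi) L).
  apply/matrixP => i j; rewrite !mxE; apply/fpsP => -[|m]; apply/fpsP => n //=.
  exact: rmorph0.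
have eD : map_mx f ((fps_const (fps_var A) - fps_var (fps A)) *:
    map_mx (in_alg (fps (fps A))) R - ((q - q^-1) *: fps_const (fps_var A))%:M)
  = (fps_const (fps_var B) - fps_var (fps B)) *:
    map_mx (in_alg (fps (fps B))) R - ((q - q^-1) *: fps_const (fps_var B))%:M.
  rewrite map_mxB map_mxZ map_scalar_mx eR rmorphB fu fv.
  by rewrite -[(q - q^-1) *: _]mulr_algl rmorphM fA fv mulr_algl.
rewrite -[LHS]/(map_mx f _) /yangian_rel map_mx_exchange map_at_first map_at_first.
by rewrite eu ev eR eD.
Qed.

Section Quotient.
Variables (K : fieldType) (N : nat) (R : 'M[K]_#|midx N 2|) (q : K).

Let pi : {lrmorphism free_alg K (nat * 'I_N * 'I_N)%type -> yangian R q} :=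
  @quot_pi K _ _.

Lemma yangian_L_coef0 i j : yangian_L R q i j 0%N = (i == j)%:R.
Proof. by rewrite !mxE /=; exact: (rmorph_nat pi). Qed.

Lemma yangian_L_rel : yangian_rel R q (yangian_L R q) = 0.
Proof.
rewrite -[LHS](map_yangian_rel R q pi).
apply/matrixP => i j; rewrite [LHS]mxE [RHS]mxE; apply/fpsP => a; apply/fpsP => b.
rewrite -[LHS]/(pi (yangian_rel R q (free_L K N) i j a b)).
transitivity (quot_pi (ideal2_gen (@yangian_proper K N R q)) 0); last exact: (rmorph0 pi).
apply/quot_piP; rewrite subr0 -[X in ideal2_mem _ X]mulr1 -[X in ideal2_mem _ (X * _)]mul1r.
by apply: ideal_genM; exists i, j, a, b.
Qed.

End Quotient.

Theorem proposition26 (K : fieldType) (N m : nat) (R Psi : 'M[K]_#|midx N 2|) (q : K)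
  (hK : real_or_complex K)
  (hq0 : q != 0)
  (hq : forall n : int, n != 0 -> q ^ n != 1)
  (hR : hecke_symmetry R q)
  (hPsi : skew_inverse R Psi)
  (hm : (2 <= m)%N)
  (hbirank : birank0 R q m) :
  let C := C_matrix Psi in
  let L := yangian_L R q in
  \sum_(p < m.+1)
     ((- q) ^+ p)%:A *:
       (map_mx (fps_dil (q ^- (2 * p))) (Lpow R q C L (m - p))
        *m (elem_sym R q C L p)%:M)
  = 0.
Proof.
have [_ P0] := hbirank.
exact: (cayley_hamilton hq0 hq hR hPsi (@yangian_L_rel K N R q)
  (@yangian_L_coef0 K N R q) (ltnW hm) (P0 _ (ltnSn m))).
Qed.
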